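(* Let $\mathfrak g$ be a finite-dimensional complex simple Lie algebra and let $\mathcal F$ be the category of finite-dimensional $\mathfrak g[t]$-modules. Let $V\in\mathcal F$ be irreducible. Then $$\dim\mathrm{Ext}^1_{\mathfrak g[t]}(\mathbb C,V)\le1,$$ with equality holding if and only if $V\cong\mathfrak g(\mathrm{ad},a\,\mathrm{ad})$ for some $a\in\mathbb C$. Moreover, if $V'\in\mathcal F$ is also irreducible, then $$\dim\mathrm{Ext}^1_{\mathfrak g[t]}(V,V')=\sum_{a\in\mathbb C}\dim\mathrm{Hom}_{\mathfrak g[t]}(\mathfrak g(\mathrm{ad},a\,\mathrm{ad}),V^*\otimes V').$$ In particular, $\mathrm{Ext}^1_{\mathfrak g[t]}(V,V)\ne0$.
   Context: $\mathfrak g[t]=\mathfrak g\otimes\mathbb C[t]$ is the current algebra with bracket $[x\otimes f,y\otimes g]=[x,y]\otimes fg$. $\mathbb C$ denotes the trivial one-dimensional $\mathfrak g[t]$-module. For $a\in\mathbb C$, $\mathfrak g(\mathrm{ad},a\,\mathrm{ad})$ is the evaluation module obtained by pulling back the adjoint representation of $\mathfrak g$ through the homomorphism $\mathrm{ev}_a:\mathfrak g[t]\to\mathfrak g$, $x\otimes f\mapsto f(a)x$. $\mathrm{Ext}^1_{\mathfrak g[t]}(V,W)$ is the vector space of equivalence classes of extensions $0\to W\to U\to V\to0$ of $\mathfrak g[t]$-modules. $V^*$ is the dual module.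
   Formalization: The final claim Ext^1(V,V) ≠ 0 is stated only for irreducible V not isomorphic to the trivial module C: for V = C it is false, since g[t] is perfect and hence Ext^1(C,C) = 0. *)

(* Defs.v *)
From HB Require Import structures.
From mathcomp Require Import all_boot all_order all_algebra.
From mathcomp Require Import all_classical all_reals.
From mathcomp Require Export complex.

Set Implicit Arguments.
Unset Strict Implicit.
Unset Printing Implicit Defensive.

Import GRing.Theory.
Local Open Scope ring_scope.
Local Open Scope quotient_scope.

Lemma lfun_linearE (K : fieldType) (U V : vectType K) (f : U -> V) :
  linear f -> linfun f =1 f.
Proof.
move=> lin_f.
pose F : {linear U -> V} := HB.pack f (GRing.isLinear.Build _ _ _ _ f lin_f).
exact: (lfunE F).
Qed.

Section LinearPlain.
Variables (K : fieldType) (U V : lmodType K) (f : U -> V).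
Hypothesis lin_f : linear f.
Let F : {linear U -> V} := HB.pack f (GRing.isLinear.Build _ _ _ _ f lin_f).
Lemma plin0 : f 0 = 0. Proof. exact: (linear0 F). Qed.
Lemma plinD u v : f (u + v) = f u + f v. Proof. exact: (linearD F). Qed.
Lemma plinB u v : f (u - v) = f u - f v. Proof. exact: (linearB F). Qed.
Lemma plinN u : f (- u) = - f u. Proof. exact: (linearN F). Qed.
Lemma plinZ a u : f (a *: u) = a *: f u. Proof. exact: (linearZ_LR F). Qed.
Lemma plin_sum I r (P : pred I) (E : I -> U) :
  f (\sum_(i <- r | P i) E i) = \sum_(i <- r | P i) f (E i).
Proof. exact: (linear_sum F). Qed.
End LinearPlain.

HB.mixin Record Lmodule_isLieAlg (K : fieldType) L of GRing.Lmodule K L := {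
  lie : L -> L -> L;
  lie_linearl : forall y, linear (lie^~ y);
  lie_linearr : forall x, linear (lie x);
  liexx : forall x, lie x x = 0;
  lie_jacobi : forall x y z,
    lie x (lie y z) + lie y (lie z x) + lie z (lie x y) = 0
}.

#[short(type="lieAlgType")]
HB.structure Definition LieAlg (K : fieldType) :=
  {L of GRing.Lmodule K L & Lmodule_isLieAlg K L}.

#[short(type="finLieAlgType")]
HB.structure Definition FinLieAlg (K : fieldType) :=
  {L of Vector K L & LieAlg K L}.

Section LieTheory.
Variables (K : fieldType) (L : lieAlgType K).
Implicit Types x y z : L.

Lemma lieC x y : lie x y = - lie y x.
Proof.
apply/eqP; rewrite -addr_eq0; apply/eqP.
have := liexx (x + y).
by rewrite (plinD (lie_linearl _)) !(plinD (lie_linearr _)) !liexx add0r addr0.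
Qed.

Lemma lie_leibniz x y z : lie (lie x y) z = lie x (lie y z) - lie y (lie x z).
Proof.
have := lie_jacobi x y z.
rewrite (lieC z x) (lieC z (lie x y)) (plinN (lie_linearr _)).
by move/eqP; rewrite subr_eq0 => /eqP ->.
Qed.

End LieTheory.

Definition simple_lie (K : fieldType) (g : finLieAlgType K) : Prop :=
  (exists x y : g, lie x y != 0) /\
  (forall I : {vspace g},
     (forall x y : g, y \in I -> lie x y \in I) -> I = 0%VS \/ I = fullv).

Record lieHom (K : fieldType) (L L' : lieAlgType K) := LieHom {
  lie_hom :> L -> L';
  lie_hom_linear : linear lie_hom;
  lie_hom_lie : forall x y, lie_hom (lie x y) = lie (lie_hom x) (lie_hom y)
}.

(* Tensor products: an element of V (x) W is written uniquely as a sum of     *)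
(* e_i (x) w_i, where e is the chosen basis of V; it is stored as (w_i)_i.    *)
(* [tens_liftE] and [tens_ind] give the universal property.                   *)

Definition tensor (K : fieldType) (V : vectType K) (W : lmodType K) : Type :=
  {ffun 'I_(\dim {:V}) -> W}.

HB.instance Definition _ (K : fieldType) (V : vectType K) (W : lmodType K) :=
  GRing.Lmodule.copy (tensor V W) {ffun 'I_(\dim {:V}) -> W}.
HB.instance Definition _ (K : fieldType) (V W : vectType K) :=
  Vector.copy (tensor V W) {ffun 'I_(\dim {:V}) -> W}.

Section Tensor.
Variables (K : fieldType) (V : vectType K) (W : lmodType K).

Definition pure (v : V) (w : W) : tensor V W :=
  [ffun i => coord (vbasis {:V}) i v *: w].

Definition tens_lift (U : lmodType K) (b : V -> W -> U) (u : tensor V W) : U :=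
  \sum_(i < \dim {:V}) b (vbasis {:V})`_i (u i).

Lemma pure_linearl w : linear (pure^~ w).
Proof.
by move=> a v v'; apply/ffunP=> i; rewrite !ffunE linearP scalerDl scalerA.
Qed.

Lemma pure_linearr v : linear (pure v).
Proof.
move=> a w w'; apply/ffunP=> i; rewrite !ffunE scalerDr !scalerA.
by rewrite mulrC.
Qed.

Lemma tens_liftE (U : lmodType K) (b : V -> W -> U) v w :
    (forall w, linear (b^~ w)) -> (forall v, linear (b v)) ->
  tens_lift b (pure v w) = b v w.
Proof.
move=> linl linr; rewrite {2}(coord_vbasis (memvf v)) (plin_sum (linl w)).
apply: eq_bigr => i _; rewrite ffunE (plinZ (linr _)).
by rewrite (plinZ (linl _)).
Qed.

Lemma tens_lift_linear (U : lmodType K) (b : V -> W -> U) :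
  (forall v, linear (b v)) -> linear (tens_lift b).
Proof.
move=> linr a u u'; rewrite /tens_lift scaler_sumr -big_split.
by apply: eq_bigr => i _; rewrite /= !ffunE linr.
Qed.

Lemma tensE (u : tensor V W) : u = \sum_(i < \dim {:V}) pure (vbasis {:V})`_i (u i).
Proof.
apply/ffunP=> j; rewrite sum_ffunE (bigD1 j) //= big1 => [|i neq_ij].
  by rewrite addr0 ffunE coord_free ?eqxx ?scale1r ?(basis_free (vbasisP _)).
rewrite ffunE coord_free ?(basis_free (vbasisP _)) //.
by rewrite -val_eqE eq_sym in neq_ij *; rewrite (negPf neq_ij) scale0r.
Qed.

Lemma tens_ind (P : tensor V W -> Prop) :
    P 0 -> (forall u u', P u -> P u' -> P (u + u')) ->
    (forall v w, P (pure v w)) ->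
  forall u, P u.
Proof.
by move=> P0 PD Pp u; rewrite (tensE u); elim/big_rec: _ => // i x _; apply: PD.
Qed.

End Tensor.

Notation "v *t w" := (pure v w) (at level 40, left associativity).

Section Current.
Variables (K : fieldType) (g : finLieAlgType K).

Definition current : Type := tensor g {poly K}.
HB.instance Definition _ := GRing.Lmodule.on current.

Definition current_lie (u v : current) : current :=
  tens_lift (fun x p =>
    tens_lift (fun y q => lie x y *t (p * q) : current) v) u.

Lemma current_lie_linearr u : linear (current_lie u).
Proof.
move=> a v v'; rewrite /current_lie /tens_lift scaler_sumr -big_split.
apply: eq_bigr => i _ /=.
pose b y q : current := lie (vbasis {:g})`_i y *t (u i * q).
suff lin_b y : linear (b y) by exact: (tens_lift_linear lin_b).
by move=> c p q; rewrite /b mulrDr -scalerAr pure_linearr.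
Qed.

Lemma current_lie_linearl v : linear (current_lie^~ v).
Proof.
apply: tens_lift_linear => x b p q; rewrite /tens_lift scaler_sumr.
rewrite -big_split; apply: eq_bigr => i _ /=.
by rewrite mulrDl -scalerAl pure_linearr.
Qed.

Lemma current_lie_pure x p y q :
  current_lie (x *t p) (y *t q) = lie x y *t (p * q).
Proof.
rewrite /current_lie tens_liftE => [|r a z z'|z a r r'].
- rewrite tens_liftE // => [r|z] a z1 z2.
    by rewrite (lie_linearr x a) pure_linearl.
  by rewrite mulrDr -scalerAr pure_linearr.
- rewrite /tens_lift scaler_sumr -big_split; apply: eq_bigr => i _ /=.
  by rewrite (lie_linearl _ a) pure_linearl.
rewrite /tens_lift scaler_sumr -big_split; apply: eq_bigr => i _ /=.
by rewrite mulrDl -scalerAl pure_linearr.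
Qed.

Lemma current_lieC u v : current_lie u v = - current_lie v u.
Proof.
pose Dl w := plinD (current_lie_linearl w).
pose Dr w := plinD (current_lie_linearr w).
elim/tens_ind: u => [|u u' IHu IHu'|x p].
- by rewrite (plin0 (current_lie_linearl _)) (plin0 (current_lie_linearr _)) oppr0.
- by rewrite Dl Dr opprD IHu IHu'.
elim/tens_ind: v => [|v v' IHv IHv'|y q].
- by rewrite (plin0 (current_lie_linearl _)) (plin0 (current_lie_linearr _)) oppr0.
- by rewrite Dl Dr opprD IHv IHv'.
rewrite !current_lie_pure lieC mulrC.
exact: (plinN (@pure_linearl K g {poly K} (q * p))).
Qed.

Lemma current_liexx u : current_lie u u = 0.
Proof.
elim/tens_ind: u => [|u u' IHu IHu'|x p].
- exact: (plin0 (current_lie_linearl _)).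
- rewrite (plinD (current_lie_linearl _)) !(plinD (current_lie_linearr _)).
  by rewrite IHu IHu' add0r addr0 (current_lieC u u') addNr.
rewrite current_lie_pure liexx.
exact: (plin0 (@pure_linearl K g {poly K} (p * p))).
Qed.

Lemma current_lie_jacobi u v w :
  current_lie u (current_lie v w) + current_lie v (current_lie w u) +
  current_lie w (current_lie u v) = 0.
Proof.
pose l0 z := plin0 (current_lie_linearl z).
pose r0 z := plin0 (current_lie_linearr z).
pose Dl z := plinD (current_lie_linearl z).
pose Dr z := plinD (current_lie_linearr z).
have AC (a b c a' b' c' : current) : a + b + c = 0 -> a' + b' + c' = 0 ->
    a + a' + (b + b') + (c + c') = 0.
  by move=> E E'; rewrite [a + a' + _]addrACA [LHS]addrACA E E' addr0.
elim/tens_ind: u => [|u u' IHu IHu'|x p].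
- by rewrite ?(l0, r0) !addr0.
- by rewrite !(Dl, Dr); apply: AC.
elim/tens_ind: v => [|v v' IHv IHv'|y q].
- by rewrite ?(l0, r0) !addr0.
- by rewrite !(Dl, Dr); apply: AC.
elim/tens_ind: w => [|w w' IHw IHw'|z r].
- by rewrite ?(l0, r0) !addr0.
- by rewrite !(Dl, Dr); apply: AC.
rewrite !current_lie_pure.
have -> : q * (r * p) = p * (q * r) by rewrite (mulrC r p) mulrCA.
have -> : r * (p * q) = p * (q * r) by rewrite mulrC mulrA.
pose D := plinD (@pure_linearl K g {poly K} (p * (q * r))).
by rewrite -!D lie_jacobi (plin0 (@pure_linearl K g {poly K} _)).
Qed.

HB.instance Definition _ := Lmodule_isLieAlg.Build K current
  current_lie_linearl current_lie_linearr current_liexx current_lie_jacobi.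

Lemma lie_pure (x y : g) (p q : {poly K}) :
  lie (x *t p : current) (y *t q : current) = lie x y *t (p * q).
Proof. exact: current_lie_pure. Qed.

Definition eval_at (a : K) (u : current) : g :=
  tens_lift (fun x p => p.[a] *: x) u.

Lemma eval_at_linear a : linear (eval_at a).
Proof.
by apply: tens_lift_linear => x b p q; rewrite hornerD hornerZ scalerDl scalerA.
Qed.

Lemma eval_at_pure a x p : eval_at a (x *t p) = p.[a] *: x.
Proof.
apply: tens_liftE => [q b y z|y b q r].
  by rewrite scalerDr !scalerA mulrC.
by rewrite hornerD hornerZ scalerDl scalerA.
Qed.

Lemma eval_at_lie a (u v : current) :
  eval_at a (lie u v) = lie (eval_at a u) (eval_at a v).
Proof.
pose E0 := plin0 (eval_at_linear a); pose ED := plinD (eval_at_linear a).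
elim/tens_ind: u => [|u u' IHu IHu'|x p].
- by rewrite (plin0 (lie_linearl _)) E0 (plin0 (lie_linearl _)).
- by rewrite (plinD (lie_linearl _)) !ED (plinD (lie_linearl _)) IHu IHu'.
elim/tens_ind: v => [|v v' IHv IHv'|y q].
- by rewrite (plin0 (lie_linearr _)) E0 (plin0 (lie_linearr _)).
- by rewrite (plinD (lie_linearr _)) !ED (plinD (lie_linearr _)) IHv IHv'.
rewrite lie_pure !eval_at_pure hornerM (plinZ (lie_linearl _)).
by rewrite (plinZ (lie_linearr _)) scalerA.
Qed.

Definition eval_hom (a : K) : lieHom current g :=
  LieHom (eval_at_linear a) (eval_at_lie a).

End Current.

Record lieModule (K : fieldType) (L : lieAlgType K) := LieModule {
  lmod_space :> vectType K;
  act : L -> lmod_space -> lmod_space;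
  act_linearl : forall v, linear (act^~ v);
  act_linearr : forall x, linear (act x);
  act_lie : forall x y v, act (lie x y) v = act x (act y v) - act y (act x v)
}.
Arguments LieModule {K L} lmod_space act _ _ _.
Arguments act {K L l}.

Record modHom (K : fieldType) (L : lieAlgType K) (V W : lieModule L) := ModHom {
  mod_hom :> 'Hom(V, W);
  mod_hom_act : forall x v, mod_hom (act x v) = act x (mod_hom v)
}.
Arguments ModHom {K L V W} mod_hom _.

Section Modules.
Variables (K : fieldType) (L : lieAlgType K).
Implicit Types V W : lieModule L.

Definition mod_iso V W : Prop := exists f : modHom V W, bijective f.

Definition submodule V (U : {vspace V}) : Prop :=
  forall (x : L) v, v \in U -> act x v \in U.

Definition irreducible V : Prop :=
  {:V}%VS != 0%VS /\
  (forall U : {vspace V}, submodule U -> U = 0%VS \/ U = fullv).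

Lemma vspace_of_pred (T : vectType K) (P : T -> Prop) :
    P 0 -> (forall a u v, P u -> P v -> P (a *: u + v)) ->
  {U : {vspace T} | forall v, v \in U <-> P v}.
Proof.
move=> P0 PL; apply: cid.
have grow m (U : {vspace T}) : (forall v, v \in U -> P v) ->
    (\dim {:T} - \dim U <= m)%N -> exists U' : {vspace T}, forall v, v \in U' <-> P v.
  elim: m U => [|m IHm] U UP le_m.
    exists U => v; split=> [/UP // | _]; suff ->: U = fullv by rewrite memvf.
    by apply/eqP; rewrite eqEdim subvf /= -subn_eq0 -leqn0.
  have [[v [Pv vU]]|noV] := pselect (exists v, P v /\ v \notin U); last first.
    exists U => v; split=> [/UP // | Pv]; apply: contrapT => /negP vU.
    by apply: noV; exists v.
  apply: (IHm (U + <[v]>)%VS).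
    move=> _ /memv_addP[u uU [_ /vlineP[a ->] ->]].
    by rewrite addrC; apply: PL => //; apply: UP.
  have lt_U : (\dim U < \dim (U + <[v]>))%N.
    rewrite ltn_neqAle (dimvS (addvSl _ _)) andbT; apply: contra vU => /eqP eqd.
    suff ->: U = (U + <[v]>)%VS by rewrite memvE addvSr.
    by apply/eqP; rewrite eqEdim addvSl eqd leqnn.
  have le_full := dimvS (subvf (U + <[v]>)%VS).
  by rewrite -ltnS (leq_trans _ le_m) // ltn_sub2l // (leq_trans lt_U).
by apply: (grow _ 0%VS _ (leqnn _)) => v; rewrite memv0 => /eqP ->.
Qed.

Fact homs_key V W :
  {U : {vspace 'Hom(V, W)} |
     forall f, f \in U <-> forall x v, f (act x v) = act x (f v)}.
Proof.
apply: vspace_of_pred => [x v|a f f' Ef Ef' x v].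
  by rewrite !zero_lfunE (plin0 (act_linearr _)).
by rewrite !add_lfunE !scale_lfunE (act_linearr x a) Ef Ef'.
Qed.

Definition homs V W : {vspace 'Hom(V, W)} := sval (homs_key V W).

Lemma homsP V W (f : 'Hom(V, W)) :
  f \in homs V W <-> forall x v, f (act x v) = act x (f v).
Proof. exact: svalP (homs_key V W) f. Qed.

Definition triv_act (x : L) (v : K^o) : K^o := 0.

Fact triv_linearl v : linear (triv_act^~ v).
Proof. by move=> a x y; rewrite /triv_act scaler0 addr0. Qed.
Fact triv_linearr x : linear (triv_act x).
Proof. by move=> a u v; rewrite /triv_act scaler0 addr0. Qed.
Fact triv_lie x y v : triv_act (lie x y) v =
  triv_act x (triv_act y v) - triv_act y (triv_act x v).
Proof. by rewrite /triv_act subrr. Qed.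

Definition triv_mod : lieModule L :=
  LieModule K^o triv_act triv_linearl triv_linearr triv_lie.

Definition dual_act V (x : L) (f : 'Hom(V, K^o)) : 'Hom(V, K^o) :=
  linfun (fun v => - f (act x v)).

Lemma dual_actE V x (f : 'Hom(V, K^o)) v : dual_act x f v = - f (act x v).
Proof.
apply: lfun_linearE => a u w.
by rewrite (act_linearr x a) linearP opprD scalerN.
Qed.

Fact dual_linearl V f : linear ((@dual_act V)^~ f).
Proof.
move=> a x y; apply/lfunP=> v; rewrite add_lfunE scale_lfunE !dual_actE.
by rewrite (act_linearl v a) linearP opprD scalerN.
Qed.
Fact dual_linearr V x : linear (@dual_act V x).
Proof.
move=> a f f'; apply/lfunP=> v; rewrite add_lfunE scale_lfunE !dual_actE.
by rewrite add_lfunE scale_lfunE opprD scalerN.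
Qed.
Fact dual_lie V x y (f : 'Hom(V, K^o)) :
  dual_act (lie x y) f = dual_act x (dual_act y f) - dual_act y (dual_act x f).
Proof.
apply/lfunP=> v; rewrite add_lfunE opp_lfunE !dual_actE.
by rewrite act_lie linearB !opprK opprB.
Qed.

Definition dual_mod V : lieModule L :=
  LieModule 'Hom(V, K^o) (@dual_act V)
    (@dual_linearl V) (@dual_linearr V) (@dual_lie V).

Definition tens_act V W (x : L) (u : tensor V W) : tensor V W :=
  tens_lift (fun v w => act x v *t w + v *t act x w) u.

Lemma tens_act_linearl V W (u : tensor V W) : linear ((@tens_act V W)^~ u).
Proof.
move=> a x y; rewrite /tens_act /tens_lift scaler_sumr -big_split.
apply: eq_bigr => i _ /=.
rewrite (act_linearl _ a x y) (act_linearl (u i) a x y).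
by rewrite pure_linearl pure_linearr scalerDr addrACA.
Qed.

Lemma tens_act_linearr V W (x : L) : linear (@tens_act V W x).
Proof.
apply: tens_lift_linear => v a w w'.
by rewrite (act_linearr x a) !pure_linearr scalerDr addrACA.
Qed.

Lemma tens_act_pure V W x (v : V) (w : W) :
  tens_act x (v *t w) = act x v *t w + v *t act x w.
Proof.
apply: tens_liftE => [y a u u'|u a y y'].
  by rewrite (act_linearr x a) !pure_linearl scalerDr addrACA.
by rewrite (act_linearr x a) !pure_linearr scalerDr addrACA.
Qed.

Lemma zmod_cancel (T : zmodType) (a b c d a' d' : T) :
  a - a' + (d - d') = a + b + (c + d) - (a' + c + (b + d')).
Proof.
have -> : a + b + (c + d) = (a + d) + (b + c) by rewrite [c + d]addrC addrACA.
have -> : a' + c + (b + d') = (a' + d') + (b + c).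
  by rewrite [b + d']addrC addrACA [c + b]addrC.
by rewrite [a' + d' + _]addrC [RHS]addrKA opprD addrACA.
Qed.

Lemma tens_act_lie V W x y (u : tensor V W) :
  tens_act (lie x y) u = tens_act x (tens_act y u) - tens_act y (tens_act x u).
Proof.
pose E0 z := plin0 (@tens_act_linearr V W z).
pose ED z := plinD (@tens_act_linearr V W z).
elim/tens_ind: u => [|u u' IHu IHu'|v w]; first by rewrite !E0 subr0.
  by rewrite !ED IHu IHu' opprD addrACA.
rewrite !tens_act_pure !ED !tens_act_pure !act_lie.
rewrite (plinB (@pure_linearl K V W w)) (plinB (@pure_linearr K V W v)).
exact: zmod_cancel.
Qed.

Definition tens_mod V W : lieModule L :=
  LieModule (tensor V W) (@tens_act V W) (@tens_act_linearl V W)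
    (@tens_act_linearr V W) (@tens_act_lie V W).

End Modules.

Section Pullback.
Variables (K : fieldType).

Definition adjoint_mod (g : finLieAlgType K) : lieModule g :=
  LieModule g lie (@lie_linearl K g) (@lie_linearr K g) (@lie_leibniz K g).

Variables (L L' : lieAlgType K) (h : lieHom L L') (V : lieModule L').

Definition pull_act (x : L) (v : V) : V := act (h x) v.

Fact pull_linearl v : linear (pull_act^~ v).
Proof. by move=> a x y; rewrite /pull_act lie_hom_linear (act_linearl v a). Qed.
Fact pull_linearr x : linear (pull_act x).
Proof. exact: act_linearr. Qed.
Fact pull_lie x y v : pull_act (lie x y) v =
  pull_act x (pull_act y v) - pull_act y (pull_act x v).
Proof. by rewrite /pull_act lie_hom_lie act_lie. Qed.

Definition pullback_mod : lieModule L :=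
  LieModule V pull_act pull_linearl pull_linearr pull_lie.

End Pullback.

Definition eval_mod (K : fieldType) (g : finLieAlgType K) (a : K) :
    lieModule (current g) :=
  pullback_mod (eval_hom g a) (adjoint_mod g).

Section Constructions.
Variables (K : fieldType) (L : lieAlgType K).
Implicit Types V W : lieModule L.

Definition sum_act V W (x : L) (u : V * W) : V * W := (act x u.1, act x u.2).

Fact sum_linearl V W u : linear ((@sum_act V W)^~ u).
Proof.
move=> a x y; rewrite /sum_act (act_linearl u.1 a x y).
by rewrite (act_linearl u.2 a x y).
Qed.
Fact sum_linearr V W x : linear (@sum_act V W x).
Proof.
by move=> a [u1 u2] [v1 v2]; congr (_, _); apply: (act_linearr x a).
Qed.
Fact sum_lie V W x y (u : V * W) :
  sum_act (lie x y) u = sum_act x (sum_act y u) - sum_act y (sum_act x u).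
Proof. by congr (_, _); apply: act_lie. Qed.

Definition sum_mod V W : lieModule L :=
  LieModule (V * W)%type (@sum_act V W)
    (@sum_linearl V W) (@sum_linearr V W) (@sum_lie V W).

Section Sub.
Variables (V : lieModule L) (U : {vspace V}) (subU : submodule U).

Definition sub_act (x : L) (u : subvs_of U) : subvs_of U :=
  vsproj U (act x (vsval u)).

Lemma sub_actE x u : vsval (sub_act x u) = act x (vsval u).
Proof. by rewrite vsprojK // subU // subvsP. Qed.

Fact sub_linearl u : linear (sub_act^~ u).
Proof. by move=> a x y; rewrite /sub_act (act_linearl _ a) linearP. Qed.
Fact sub_linearr x : linear (sub_act x).
Proof. by move=> a u v; rewrite /sub_act linearP (act_linearr x a) linearP. Qed.
Fact sub_lie x y u :
  sub_act (lie x y) u = sub_act x (sub_act y u) - sub_act y (sub_act x u).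
Proof. by apply: val_inj; rewrite linearB /= !sub_actE act_lie. Qed.

Definition sub_mod : lieModule L :=
  LieModule (subvs_of U) sub_act sub_linearl sub_linearr sub_lie.

End Sub.

Section Quotient.
Variables (V : lieModule L) (U : {vspace V}) (subU : submodule U).

(* The quotient space V / U is realized on the complement U^C, the canonical  *)
(* surjection being the projection onto U^C along U.                          *)
Definition quo_space : vectType K := subvs_of (U^C)%VS.
Definition quo_proj : 'Hom(V, quo_space) :=
  linfun (fun v => vsproj (U^C)%VS (daddv_pi (U^C)%VS U v)).
Definition quo_repr : 'Hom(quo_space, V) := linfun (@vsval K V (U^C)%VS).

Lemma quo_projE v : quo_proj v = vsproj (U^C)%VS (daddv_pi (U^C)%VS U v).
Proof. by apply: lfun_linearE => a u w; rewrite !linearP. Qed.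

Lemma quo_reprE q : quo_repr q = vsval q.
Proof. by rewrite lfunE. Qed.

Lemma quo_reprK q : quo_proj (quo_repr q) = q.
Proof.
rewrite quo_projE quo_reprE daddv_pi_id ?vsvalK ?subvsP //.
by rewrite capvC capv_compl.
Qed.

Lemma quo_proj_sub v : v - quo_repr (quo_proj v) \in U.
Proof.
rewrite quo_projE quo_reprE vsprojK ?memv_pi //.
have cap0 : (U^C :&: U = 0)%VS by rewrite capvC capv_compl.
have vUU : v \in (U^C + U)%VS by rewrite addvC addv_complf memvf.
have defv := daddv_pi_add cap0 vUU.
by rewrite -[X in X - _]defv addrC addKr memv_pi.
Qed.

Lemma quo_proj_eq0 v : (quo_proj v == 0) = (v \in U).
Proof.
apply/eqP/idP => [qv0|vU].
  by have := quo_proj_sub v; rewrite qv0 linear0 subr0.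
suff : quo_repr (quo_proj v) \in (U :&: U^C)%VS.
  rewrite capv_compl memv0 => /eqP qv0.
  by rewrite -[quo_proj v]quo_reprK qv0 linear0.
rewrite memv_cap {2}quo_reprE subvsP andbT.
by rewrite -[quo_repr _](subKr v) memvB // quo_proj_sub.
Qed.

Definition quo_act (x : L) (q : quo_space) : quo_space :=
  quo_proj (act x (quo_repr q)).

Lemma quo_actE x v : quo_act x (quo_proj v) = quo_proj (act x v).
Proof.
apply/eqP; rewrite eq_sym -subr_eq0 -linearB /= quo_proj_eq0.
by rewrite -(plinB (act_linearr x)) subU // quo_proj_sub.
Qed.

Fact quo_linearl q : linear (quo_act^~ q).
Proof. by move=> a x y; rewrite /quo_act (act_linearl _ a) linearP. Qed.
Fact quo_linearr x : linear (quo_act x).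
Proof. by move=> a u v; rewrite /quo_act linearP (act_linearr x a) linearP. Qed.
Fact quo_lie x y q :
  quo_act (lie x y) q = quo_act x (quo_act y q) - quo_act y (quo_act x q).
Proof.
rewrite -[q]quo_reprK !quo_actE act_lie linearB.
by [].
Qed.

Definition quo_mod : lieModule L :=
  LieModule quo_space quo_act quo_linearl quo_linearr quo_lie.

End Quotient.
End Constructions.

Section Extensions.
Variables (K : fieldType) (L : lieAlgType K).
Implicit Types V W : lieModule L.

Fact mk_hom_act V W (f : V -> W) (linf : linear f)
    (actf : forall x v, f (act x v) = act x (f v)) x v :
  linfun f (act x v) = act x (linfun f v).
Proof. by rewrite !(lfun_linearE linf). Qed.

Definition mk_hom V W (f : V -> W) (linf : linear f)
    (actf : forall x v, f (act x v) = act x (f v)) : modHom V W :=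
  ModHom (linfun f) (mk_hom_act linf actf).

Lemma mk_homE V W f linf actf : @mk_hom V W f linf actf =1 f.
Proof. exact: lfun_linearE. Qed.

Record extension V W := Extension {
  ext_mod :> lieModule L;
  ext_inj : modHom W ext_mod;
  ext_proj : modHom ext_mod V;
  ext_inj_ker : lker ext_inj = 0%VS;
  ext_proj_img : limg ext_proj = fullv;
  ext_exact : limg ext_inj = lker ext_proj
}.

(* Equivalence of extensions: a morphism between the middle terms which is    *)
(* the identity on both ends (hence an isomorphism, by the five lemma).       *)
Definition ext_equiv V W (E F : extension V W) : Prop :=
  exists f : modHom E F,
    (forall w, f (ext_inj E w) = ext_inj F w) /\
    (forall u, ext_proj F (f u) = ext_proj E u).

Section ExtTheory.
Variables (V W : lieModule L) (E : extension V W).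

Lemma ext_inj_inj : injective (ext_inj E).
Proof. by apply/lker0P; rewrite ext_inj_ker. Qed.

Lemma ext_inj_eq0 w : ext_inj E w = 0 -> w = 0.
Proof. by move=> iw0; apply: ext_inj_inj; rewrite iw0 linear0. Qed.

Lemma ext_proj_surj v : exists u, ext_proj E u = v.
Proof.
have /memv_imgP[u _ ->] : v \in limg (ext_proj E) by rewrite ext_proj_img memvf.
by exists u.
Qed.

Lemma ext_projK w : ext_proj E (ext_inj E w) = 0.
Proof.
by apply/eqP; rewrite -memv_ker -ext_exact memv_img ?memvf.
Qed.

Lemma ext_proj_eq0 u : ext_proj E u = 0 -> exists w, u = ext_inj E w.
Proof.
move/eqP; rewrite -memv_ker -ext_exact => /memv_imgP[w _ ->].
by exists w.
Qed.

End ExtTheory.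

Section MkExtension.
Variables (V W U : lieModule L) (i : modHom W U) (p : modHom U V).
Hypotheses (i_inj : forall w, i w = 0 -> w = 0)
           (p_surj : forall v, exists u, p u = v)
           (pi0 : forall w, p (i w) = 0)
           (ip_ex : forall u, p u = 0 -> exists w, u = i w).

Fact mk_ker : lker i = 0%VS.
Proof. by apply/vspaceP=> w; rewrite memv_ker memv0; apply/eqP/eqP=> [/i_inj | ->]; rewrite ?linear0. Qed.
Fact mk_img : limg p = fullv.
Proof.
apply/vspaceP=> v; rewrite memvf; have [u <-] := p_surj v.
by rewrite memv_img ?memvf.
Qed.
Fact mk_exact : limg i = lker p.
Proof.
apply/vspaceP=> u; rewrite memv_ker; apply/memv_imgP/eqP=> [[w _ ->] //|].
by move/ip_ex=> [w ->]; exists w; rewrite ?memvf.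
Qed.

Definition mk_ext : extension V W := Extension mk_ker mk_img mk_exact.
End MkExtension.

Section Split.
Variables V W : lieModule L.
Fact split_inj_lin : linear (fun w : W => (w, 0) : sum_mod W V).
Proof. by move=> a u v; congr (_, _); rewrite /= scaler0 addr0. Qed.
Fact split_inj_act x w :
  ((act x w, 0) : sum_mod W V) = act x ((w, 0) : sum_mod W V).
Proof. by congr (_, _); rewrite /= (plin0 (act_linearr _)). Qed.
Fact split_proj_lin : linear (fun u : sum_mod W V => u.2 : V).
Proof. by []. Qed.
Fact split_proj_act (x : L) (u : sum_mod W V) : (act x u).2 = act x u.2 :> V.
Proof. by []. Qed.

Definition split_ext : extension V W.
Proof.
apply: (@mk_ext V W (sum_mod W V) (mk_hom split_inj_lin split_inj_act)
          (mk_hom split_proj_lin split_proj_act)).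
- by move=> w; rewrite mk_homE => -[].
- by move=> v; exists (0, v); rewrite mk_homE.
- by move=> w; rewrite !mk_homE.
- by move=> [w v]; rewrite mk_homE => v0; exists w; rewrite mk_homE; congr (_, _).
Defined.
End Split.

Section Pushout.
Variables (V W W' : lieModule L) (E : extension V W) (a : modHom W W').

Definition push_rel : 'Hom(W, sum_mod E W') :=
  linfun (fun w => (ext_inj E w, - a w)).

Lemma push_relE w : push_rel w = (ext_inj E w, - a w).
Proof.
by apply: lfun_linearE => c u v; congr (_, _); rewrite /= linearP // opprD scalerN.
Qed.

Fact push_sub : submodule (limg push_rel).
Proof.
move=> x _ /memv_imgP[w _ ->].
suff -> : act x (push_rel w) = push_rel (act x w) by rewrite memv_img ?memvf.
rewrite !push_relE !mod_hom_act; congr (_, _).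
by rewrite /= (plinN (act_linearr _)).
Qed.

Definition push_mod : lieModule L := quo_mod push_sub.
Notation cls := (quo_proj (limg push_rel)).
Notation rep := (quo_repr (limg push_rel)).

Lemma push_ind (P : push_mod -> Prop) : (forall s, P (cls s)) -> forall q, P q.
Proof. by move=> Pc q; rewrite -[q]quo_reprK. Qed.

Fact push_inj_lin : linear (fun w' : W' => cls ((0, w') : sum_mod E W') : push_mod).
Proof.
move=> c u v; rewrite -linearP; congr (cls _).
by congr (_, _); rewrite /= scaler0 addr0.
Qed.
Fact push_inj_act x w' :
  cls ((0, act x w') : sum_mod E W') = act x (cls ((0, w') : sum_mod E W') : push_mod).
Proof.
rewrite [RHS](quo_actE push_sub); congr (cls _).
by congr (_, _); rewrite /= (plin0 (act_linearr _)).
Qed.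

Definition push_inj := mk_hom push_inj_lin push_inj_act.

Lemma push_injE w' : push_inj w' = cls ((0, w') : sum_mod E W').
Proof. exact: mk_homE. Qed.

Lemma push_projE s : ext_proj E (rep (cls s)).1 = ext_proj E s.1.
Proof.
have /memv_imgP[w _ defw] := quo_proj_sub (limg push_rel) s.
have -> : s.1 = (rep (cls s)).1 + ext_inj E w.
  by rewrite addrC; apply/eqP; rewrite -subr_eq; apply/eqP;
     have := congr1 fst defw; rewrite push_relE.
by rewrite linearD /= ext_projK addr0.
Qed.

Fact push_proj_lin : linear (fun q : push_mod => ext_proj E (rep q).1).
Proof. by move=> c u v; rewrite linearP /= linearP. Qed.
Fact push_proj_act x (q : push_mod) :
  ext_proj E (rep (act x q)).1 = act x (ext_proj E (rep q).1).
Proof.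
elim/push_ind: q => s; rewrite [act x _](quo_actE push_sub) !push_projE.
exact: mod_hom_act.
Qed.

Definition push_proj := mk_hom push_proj_lin push_proj_act.

Lemma push_rel_eq w w' :
  cls ((ext_inj E w, w') : sum_mod E W') = cls ((0, w' + a w) : sum_mod E W').
Proof.
apply/eqP; rewrite -subr_eq0 -linearB quo_proj_eq0; apply/memv_imgP.
exists w; rewrite ?memvf // push_relE; congr (_, _); rewrite /= ?subr0 //.
by rewrite opprD addNKr.
Qed.

Definition push_ext : extension V W'.
Proof.
apply: (@mk_ext V W' push_mod push_inj push_proj).
- move=> w'; rewrite mk_homE => /eqP; rewrite quo_proj_eq0.
  move=> /memv_imgP[w _]; rewrite push_relE => -[/esym/ext_inj_eq0 ->].
  by rewrite linear0 oppr0.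
- move=> v; have [u <-] := ext_proj_surj E v.
  by exists (cls ((u, 0) : sum_mod E W')); rewrite mk_homE push_projE.
- by move=> w'; rewrite !mk_homE push_projE linear0.
- elim/push_ind=> -[u w']; rewrite mk_homE push_projE => /ext_proj_eq0[w /= ->].
  by exists (w' + a w); rewrite push_rel_eq push_injE.
Defined.

End Pushout.

Section Pullback.
Variables (V V' W : lieModule L) (E : extension V W) (b : modHom V' V).

Definition pull_rel : 'Hom(sum_mod E V', V) :=
  linfun (fun s : sum_mod E V' => ext_proj E s.1 - b s.2).

Lemma pull_relE s : pull_rel s = ext_proj E s.1 - b s.2.
Proof.
apply: (@lfun_linearE K (sum_mod E V') V) => c u v /=.
by rewrite (linearP (ext_proj E)) (linearP b) scalerBr opprD addrACA.
Qed.

Lemma memv_pull s : (s \in lker pull_rel) = (ext_proj E s.1 == b s.2).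
Proof. by rewrite memv_ker pull_relE subr_eq0. Qed.

Fact pull_sub : submodule (lker pull_rel).
Proof.
by move=> x s; rewrite !memv_pull /= !mod_hom_act => /eqP ->.
Qed.

Definition pull_mod : lieModule L := sub_mod pull_sub.
Notation sub := (vsproj (lker pull_rel)).

Lemma pull_inj_mem w : ((ext_inj E w, 0) : sum_mod E V') \in lker pull_rel.
Proof. by rewrite memv_pull /= ext_projK linear0. Qed.

Fact pull_inj_lin : linear (fun w => sub (ext_inj E w, 0) : pull_mod).
Proof.
move=> c u v; rewrite -linearP; congr (sub _).
by congr (_, _); rewrite /= ?linearP // scaler0 addr0.
Qed.
Fact pull_inj_act x w :
  sub (ext_inj E (act x w), 0) = act x (sub (ext_inj E w, 0) : pull_mod).
Proof.
rewrite [RHS]/(sub _) vsprojK ?pull_inj_mem //; congr (sub _); congr (_, _).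
  exact: mod_hom_act.
by rewrite /= (plin0 (act_linearr _)).
Qed.

Definition pull_inj := mk_hom pull_inj_lin pull_inj_act.

Fact pull_proj_lin : linear (fun s : pull_mod => (vsval s).2).
Proof. by move=> c u v; rewrite linearP. Qed.
Fact pull_proj_act x (s : pull_mod) :
  (vsval (act x s)).2 = act x (vsval s).2 :> V'.
Proof. by rewrite (sub_actE pull_sub). Qed.

Definition pull_proj := mk_hom pull_proj_lin pull_proj_act.

Definition pull_ext : extension V' W.
Proof.
apply: (@mk_ext V' W pull_mod pull_inj pull_proj).
- move=> w; rewrite mk_homE => /(congr1 vsval).
  by rewrite vsprojK ?pull_inj_mem // => -[/ext_inj_eq0].
- move=> v'; have [u pu] := ext_proj_surj E (b v').
  exists (sub ((u, v') : sum_mod E V')).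
  by rewrite mk_homE vsprojK // memv_pull pu.
- by move=> w; rewrite !mk_homE vsprojK ?pull_inj_mem.
- move=> s; rewrite mk_homE => s20; have := subvsP s.
  rewrite memv_pull s20 linear0 => /eqP/ext_proj_eq0[w s1].
  exists w; rewrite mk_homE; apply: val_inj; rewrite /= vsprojK ?pull_inj_mem //.
  by case: (vsval s) s1 s20 => /= ? ? -> ->.
Defined.

End Pullback.

Section DirectSum.
Variables (V1 W1 V2 W2 : lieModule L).
Variables (E1 : extension V1 W1) (E2 : extension V2 W2).

Fact pair_lin (A1 B1 A2 B2 : lieModule L) (f1 : modHom A1 B1) (f2 : modHom A2 B2) :
  linear (fun u : sum_mod A1 A2 => (f1 u.1, f2 u.2) : sum_mod B1 B2).
Proof. by move=> c u v; congr (_, _); rewrite /= linearP. Qed.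
Fact pair_act (A1 B1 A2 B2 : lieModule L) (f1 : modHom A1 B1) (f2 : modHom A2 B2)
    x (u : sum_mod A1 A2) :
  (f1 (act x u).1, f2 (act x u).2) = act x ((f1 u.1, f2 u.2) : sum_mod B1 B2).
Proof. by congr (_, _); rewrite /= mod_hom_act. Qed.

Definition pair_hom (A1 B1 A2 B2 : lieModule L) (f1 : modHom A1 B1) (f2 : modHom A2 B2) :
    modHom (sum_mod A1 A2) (sum_mod B1 B2) :=
  mk_hom (pair_lin f1 f2) (pair_act f1 f2).

Definition dsum_ext : extension (sum_mod V1 V2) (sum_mod W1 W2).
Proof.
apply: (@mk_ext _ _ (sum_mod E1 E2) (pair_hom (ext_inj E1) (ext_inj E2))
          (pair_hom (ext_proj E1) (ext_proj E2))).
- by move=> [w1 w2]; rewrite mk_homE => -[/ext_inj_eq0 -> /ext_inj_eq0 ->].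
- move=> [v1 v2]; have [u1 <-] := ext_proj_surj E1 v1.
  have [u2 <-] := ext_proj_surj E2 v2.
  by exists (u1, u2); rewrite mk_homE.
- by move=> w; rewrite !mk_homE /= !ext_projK.
- move=> [u1 u2]; rewrite mk_homE => -[/ext_proj_eq0[w1 ->] /ext_proj_eq0[w2 ->]].
  by exists (w1, w2); rewrite mk_homE.
Defined.

End DirectSum.

Section Baer.
Variables V W : lieModule L.

Fact diag_lin : linear (fun v : V => (v, v) : sum_mod V V).
Proof. by []. Qed.
Fact diag_act (x : L) (v : V) :
  ((act x v, act x v) : sum_mod V V) = act x ((v, v) : sum_mod V V).
Proof. by []. Qed.
Definition diag_hom : modHom V (sum_mod V V) := mk_hom diag_lin diag_act.

Fact codiag_lin : linear (fun w : sum_mod W W => w.1 + w.2 : W).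
Proof. by move=> c u v; rewrite /= scalerDr addrACA. Qed.
Fact codiag_act (x : L) (w : sum_mod W W) :
  (act x w).1 + (act x w).2 = act x (w.1 + w.2) :> W.
Proof. by rewrite (plinD (act_linearr x)). Qed.
Definition codiag_hom : modHom (sum_mod W W) W := mk_hom codiag_lin codiag_act.

Fact scale_lin c : linear (fun w : W => c *: w).
Proof. by move=> a u v; rewrite scalerDr !scalerA mulrC. Qed.
Fact scale_act c (x : L) (w : W) : c *: act x w = act x (c *: w).
Proof. by rewrite (plinZ (act_linearr x)). Qed.
Definition scale_hom c : modHom W W := mk_hom (scale_lin c) (scale_act c).

(* nabla_* Delta^* (E (+) F) *)
Definition baer_sum (E F : extension V W) : extension V W :=
  push_ext (pull_ext (dsum_ext E F) diag_hom) codiag_hom.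

Definition ext_scale (c : K) (E : extension V W) : extension V W :=
  push_ext E (scale_hom c).

End Baer.
End Extensions.

(* Cocycles serve only to check the axioms of the vector space Ext^1.         *)

Section Cocycles.
Variables (K : fieldType) (L : lieAlgType K).
Implicit Types V W : lieModule L.

Definition ext_cocycle V W (E : extension V W) (g : L -> V -> W) : Prop :=
  exists s : 'Hom(V, E), (forall v, ext_proj E (s v) = v) /\
    (forall x v, act x (s v) = s (act x v) + ext_inj E (g x v)).

Definition cobordant V W (g g' : L -> V -> W) : Prop :=
  exists h : 'Hom(V, W), forall x v, g' x v = g x v + act x (h v) - h (act x v).

Lemma ext_cocycle_ex V W (E : extension V W) : exists g, ext_cocycle E g.
Proof.
pose s := ((ext_proj E)^-1)%VF.
have sK v : ext_proj E (s v) = v.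
  by rewrite /s limg_lfunVK // ext_proj_img memvf.
have ex x v : exists w, act x (s v) - s (act x v) = ext_inj E w.
  by apply: ext_proj_eq0; rewrite linearB /= mod_hom_act !sK subrr.
exists (fun x v => projT1 (cid (ex x v))), s; split=> // x v.
by case: cid => w /= <-; rewrite addrC subrK.
Qed.

Lemma ext_cocycle_shift V W (E : extension V W) g g' :
  cobordant g g' -> ext_cocycle E g -> ext_cocycle E g'.
Proof.
move=> [h def_g'] [s [sK def_g]]; exists (s + (ext_inj E \o h))%VF.
have sE v : (s + (ext_inj E \o h))%VF v = s v + ext_inj E (h v).
  by rewrite add_lfunE comp_lfunE.
split=> [v|x v]; rewrite !sE; first by rewrite linearD /= ext_projK addr0.
rewrite def_g' (plinD (act_linearr x)) def_g -mod_hom_act -!addrA; congr (_ + _).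
rewrite -!linearD /=; congr (ext_inj E _).
by rewrite [RHS]addrC -!addrA addNr addr0.
Qed.

Lemma zmod_swap (T : zmodType) (a b a' b' : T) :
  a' - b' = a - b + (a' - a) - (b' - b).
Proof. by rewrite [a - b + _]addrC addrA subrK opprB addrA subrK. Qed.

Lemma ext_cocycle_cobordant V W (E : extension V W) g g' :
  ext_cocycle E g -> ext_cocycle E g' -> cobordant g g'.
Proof.
move=> [s [sK def_g]] [s' [sK' def_g']].
have ex v : exists w, s' v - s v = ext_inj E w.
  by apply: ext_proj_eq0; rewrite linearB /= sK sK' subrr.
pose h0 v := projT1 (cid (ex v)).
have h0E v : s' v - s v = ext_inj E (h0 v) by rewrite /h0; case: cid.
have h0lin : linear h0.
  move=> c u v; apply: (@ext_inj_inj _ _ _ _ E); rewrite linearP /= -!h0E.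
  by rewrite (linearP s') (linearP s) scalerBr opprD addrACA.
exists (linfun h0) => x v; rewrite !(lfun_linearE h0lin).
apply: (@ext_inj_inj _ _ _ _ E); rewrite linearB linearD /= mod_hom_act -!h0E.
have -> : ext_inj E (g' x v) = act x (s' v) - s' (act x v).
  by rewrite def_g' addrC addKr.
have -> : ext_inj E (g x v) = act x (s v) - s (act x v).
  by rewrite def_g addrC addKr.
by rewrite (plinB (act_linearr x)); apply: zmod_swap.
Qed.

Lemma ext_cocycle_equiv V W (E F : extension V W) g :
  ext_equiv E F -> ext_cocycle E g -> ext_cocycle F g.
Proof.
move=> [f [fi pf]] [s [sK def_g]]; exists (f \o s)%VF.
split=> [v|x v]; rewrite !comp_lfunE ?pf //.
by rewrite -mod_hom_act def_g linearD /= fi.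
Qed.

Lemma ext_cocycle_inj V W (E F : extension V W) g :
  ext_cocycle E g -> ext_cocycle F g -> ext_equiv E F.
Proof.
move=> [s [sK def_g]] [s' [sK' def_g']].
have ex u : exists w, u - s (ext_proj E u) = ext_inj E w.
  by apply: ext_proj_eq0; rewrite linearB /= sK subrr.
pose r u := projT1 (cid (ex u)).
have rE u : u - s (ext_proj E u) = ext_inj E (r u) by rewrite /r; case: cid.
have rlin : linear r.
  move=> c u v; apply: (@ext_inj_inj _ _ _ _ E); rewrite linearP /= -!rE.
  by rewrite (linearP (ext_proj E)) (linearP s) scalerBr opprD addrACA.
pose f0 u := s' (ext_proj E u) + ext_inj F (r u).
have f0lin : linear f0.
  move=> c u v; rewrite /f0 (rlin c) (linearP (ext_proj E)) (linearP s').
  by rewrite (linearP (ext_inj F)) scalerDr addrACA.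
have f0act x u : f0 (act x u) = act x (f0 u).
  rewrite /f0 (plinD (act_linearr x)) def_g' mod_hom_act -addrA; congr (_ + _).
  rewrite -mod_hom_act -linearD /=; congr (ext_inj F _).
  apply: (@ext_inj_inj _ _ _ _ E); rewrite linearD /= mod_hom_act -!rE.
  rewrite (plinB (act_linearr x)) def_g mod_hom_act [RHS]addrCA.
  by rewrite opprD [_ + (- _ - _)]addrCA subrr addr0.
exists (mk_hom f0lin f0act); split=> [w|u]; rewrite mk_homE /f0.
  rewrite ext_projK linear0 add0r; congr (ext_inj F _).
  by apply: (@ext_inj_inj _ _ _ _ E); rewrite -rE ext_projK linear0 subr0.
by rewrite linearD /= sK' ext_projK addr0.
Qed.

Lemma ext_equivP V W (E F : extension V W) g g' :
  ext_cocycle E g -> ext_cocycle F g' -> ext_equiv E F <-> cobordant g g'.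
Proof.
move=> Eg Fg'; split=> [EF | gg'].
  exact: ext_cocycle_cobordant (ext_cocycle_equiv EF Eg) Fg'.
exact: ext_cocycle_inj (ext_cocycle_shift gg' Eg) Fg'.
Qed.

Lemma push_cocycle V W W' (E : extension V W) (a : modHom W W') g :
  ext_cocycle E g -> ext_cocycle (push_ext E a) (fun x v => a (g x v)).
Proof.
move=> [s [sK def_g]].
pose s0 v : push_mod E a := quo_proj (limg (push_rel E a)) (s v, 0).
have s0lin : linear s0.
  move=> c u v; rewrite /s0 -linearP; congr (quo_proj _ _).
  by congr (_, _); rewrite /= ?linearP // scaler0 addr0.
exists (linfun s0); split=> [v|x v]; rewrite !(lfun_linearE s0lin).
  by rewrite [LHS]mk_homE push_projE /= sK.
rewrite [ext_inj _ _]mk_homE [LHS](quo_actE (@push_sub _ _ _ _ _ E a)).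
have -> : act x ((s v, 0) : sum_mod E W') =
          (s (act x v), 0) + (ext_inj E (g x v), 0).
  by congr (_, _); rewrite /= ?def_g // (plin0 (act_linearr _)) addr0.
by rewrite linearD /= push_rel_eq add0r.
Qed.

Lemma pull_cocycle V V' W (E : extension V W) (b : modHom V' V) g :
  ext_cocycle E g -> ext_cocycle (pull_ext E b) (fun x v => g x (b v)).
Proof.
move=> [s [sK def_g]].
pose s0 v : pull_mod E b := vsproj (lker (pull_rel E b)) (s (b v), v).
have s0mem v : (s (b v), v) \in lker (pull_rel E b) by rewrite memv_pull sK.
have s0lin : linear s0.
  move=> c u v; rewrite /s0 -linearP; congr (vsproj _ _).
  by congr (_, _); rewrite /= !linearP.
exists (linfun s0); split=> [v|x v]; rewrite !(lfun_linearE s0lin).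
  by rewrite [LHS]mk_homE vsprojK.
rewrite [ext_inj _ _]mk_homE; apply: val_inj.
rewrite linearD /= (sub_actE (@pull_sub _ _ _ _ _ E b)) !vsprojK ?pull_inj_mem //.
by congr (_, _); rewrite /= ?addr0 // def_g mod_hom_act.
Qed.

Lemma dsum_cocycle V1 W1 V2 W2 (E1 : extension V1 W1) (E2 : extension V2 W2)
    g1 g2 : ext_cocycle E1 g1 -> ext_cocycle E2 g2 ->
  ext_cocycle (dsum_ext E1 E2)
    (fun x (v : sum_mod V1 V2) => (g1 x v.1, g2 x v.2) : sum_mod W1 W2).
Proof.
move=> [s1 [sK1 def1]] [s2 [sK2 def2]].
pose s0 (v : sum_mod V1 V2) : sum_mod E1 E2 := (s1 v.1, s2 v.2).
have s0lin : linear s0 by move=> c u v; congr (_, _); rewrite /= linearP.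
exists (linfun s0); split=> [v|x v]; rewrite !(lfun_linearE s0lin).
  by rewrite [LHS]mk_homE /= sK1 sK2; case: v.
by rewrite [ext_inj _ _]mk_homE; congr (_, _); rewrite /= ?def1 ?def2.
Qed.

Lemma baer_cocycle V W (E F : extension V W) g g' :
  ext_cocycle E g -> ext_cocycle F g' ->
  ext_cocycle (baer_sum E F) (fun x v => g x v + g' x v).
Proof.
move=> Eg Fg'.
have := push_cocycle (codiag_hom W)
  (pull_cocycle (diag_hom V) (dsum_cocycle Eg Fg')).
congr ext_cocycle; apply/funext=> x; apply/funext=> v.
by rewrite !mk_homE.
Qed.

Lemma scale_cocycle V W c (E : extension V W) g :
  ext_cocycle E g -> ext_cocycle (ext_scale c E) (fun x v => c *: g x v).
Proof.
move=> Eg; have := push_cocycle (scale_hom W c) Eg.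
by congr ext_cocycle; apply/funext=> x; apply/funext=> v; rewrite mk_homE.
Qed.

Lemma split_cocycle V W : ext_cocycle (split_ext V W) (fun _ _ => 0).
Proof.
pose s0 (v : V) : sum_mod W V := (0, v).
have s0lin : linear s0.
  by move=> c u v; congr (_, _); rewrite /= scaler0 addr0.
exists (linfun s0); split=> [v|x v]; rewrite !(lfun_linearE s0lin).
  by rewrite [LHS]mk_homE.
rewrite [ext_inj _ _]mk_homE addr0; congr (_, _).
by rewrite /= (plin0 (act_linearr _)).
Qed.

Lemma cobordant0 V W (g : L -> V -> W) : cobordant g g.
Proof.
exists 0 => x v.
by rewrite !zero_lfunE (plin0 (act_linearr _)) subr0 addr0.
Qed.

Lemma ext_equiv_same V W (E F : extension V W) g g' :
    ext_cocycle E g -> ext_cocycle F g' -> (forall x v, g x v = g' x v) ->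
  ext_equiv E F.
Proof.
move=> Eg Fg' eq_gg'; apply: (ext_cocycle_inj Eg).
suff -> : g = g' by [].
by apply/funext=> x; apply/funext=> v; apply: eq_gg'.
Qed.

Lemma ext_equiv_refl V W (E : extension V W) : ext_equiv E E.
Proof. by have [g Eg] := ext_cocycle_ex E; exact: (ext_cocycle_inj Eg Eg). Qed.

Lemma ext_equiv_sym V W (E F : extension V W) : ext_equiv E F -> ext_equiv F E.
Proof.
move=> EF; have [g Eg] := ext_cocycle_ex E.
exact: (ext_cocycle_inj (ext_cocycle_equiv EF Eg) Eg).
Qed.

Lemma ext_equiv_trans V W (E F G : extension V W) :
  ext_equiv E F -> ext_equiv F G -> ext_equiv E G.
Proof.
move=> EF FG; have [g Eg] := ext_cocycle_ex E; apply: (ext_cocycle_inj Eg).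
exact: ext_cocycle_equiv FG (ext_cocycle_equiv EF Eg).
Qed.

Lemma baer_sum_equiv V W (E E' F F' : extension V W) :
  ext_equiv E E' -> ext_equiv F F' -> ext_equiv (baer_sum E F) (baer_sum E' F').
Proof.
move=> EE' FF'; have [g Eg] := ext_cocycle_ex E; have [h Fh] := ext_cocycle_ex F.
apply: (ext_cocycle_inj (baer_cocycle Eg Fh)).
exact: baer_cocycle (ext_cocycle_equiv EE' Eg) (ext_cocycle_equiv FF' Fh).
Qed.

Lemma ext_scale_equiv V W c (E E' : extension V W) :
  ext_equiv E E' -> ext_equiv (ext_scale c E) (ext_scale c E').
Proof.
move=> EE'; have [g Eg] := ext_cocycle_ex E.
apply: (ext_cocycle_inj (scale_cocycle c Eg)).
exact: scale_cocycle (ext_cocycle_equiv EE' Eg).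
Qed.

End Cocycles.

(* Extensions whose middle term is carried by some K^n. The type [extension]  *)
(* quantifies over all vector spaces and is too large to be quotiented into   *)
(* an lmodType; every extension is equivalent to one of the following.        *)
Section SmallExt.
Variables (K : fieldType) (L : lieAlgType K).

Record rv_module := RvModule {
  rv_dim : nat;
  rv_act : L -> 'rV[K]_rv_dim -> 'rV[K]_rv_dim;
  rv_act_linearl : forall v, linear (rv_act^~ v);
  rv_act_linearr : forall x, linear (rv_act x);
  rv_act_lie : forall x y v,
    rv_act (lie x y) v = rv_act x (rv_act y v) - rv_act y (rv_act x v)
}.

Definition rv_mod (M : rv_module) : lieModule L :=
  LieModule 'rV[K]_(rv_dim M) (@rv_act M)
    (@rv_act_linearl M) (@rv_act_linearr M) (@rv_act_lie M).

Record rv_extension (V W : lieModule L) := RvExtension {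
  rv_ext_mod : rv_module;
  rv_ext_inj : modHom W (rv_mod rv_ext_mod);
  rv_ext_proj : modHom (rv_mod rv_ext_mod) V;
  rv_ext_inj_ker : lker rv_ext_inj = 0%VS;
  rv_ext_proj_img : limg rv_ext_proj = fullv;
  rv_ext_exact : limg rv_ext_inj = lker rv_ext_proj
}.

Definition ext_of_rv V W (E : rv_extension V W) : extension V W :=
  Extension (rv_ext_inj_ker E) (rv_ext_proj_img E) (rv_ext_exact E).

Import VectorInternalTheory.
Section ToRv.
Variables (V W : lieModule L) (E : extension V W).

Let r2E : 'rV[K]_(dim E) -> E := r2v.

Definition to_rv_act (x : L) (v : 'rV[K]_(dim E)) := v2r (act x (r2E v)).

Fact to_rv_linearl v : linear (to_rv_act^~ v).
Proof. by move=> a x y; rewrite /to_rv_act (act_linearl _ a) linearP. Qed.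
Fact to_rv_linearr x : linear (to_rv_act x).
Proof. by move=> a u v; rewrite /to_rv_act /r2E linearP (act_linearr x a) linearP. Qed.
Fact to_rv_lie x y v : to_rv_act (lie x y) v =
  to_rv_act x (to_rv_act y v) - to_rv_act y (to_rv_act x v).
Proof. by rewrite /to_rv_act /r2E act_lie linearB /= !v2rK. Qed.

Definition to_rv_mod : rv_module :=
  RvModule to_rv_linearl to_rv_linearr to_rv_lie.

Fact to_rv_inj_lin :
  linear (fun w : W => v2r (ext_inj E w) : rv_mod to_rv_mod).
Proof. by move=> c u v; rewrite !linearP. Qed.
Fact to_rv_inj_act x w : v2r (ext_inj E (act x w)) =
  act x (v2r (ext_inj E w) : rv_mod to_rv_mod).
Proof. by rewrite /= /to_rv_act /r2E v2rK mod_hom_act. Qed.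
Fact to_rv_proj_lin :
  linear (fun u : rv_mod to_rv_mod => ext_proj E (r2E u)).
Proof. by move=> c u v; rewrite /r2E (linearP r2v) linearP. Qed.
Fact to_rv_proj_act x (u : rv_mod to_rv_mod) :
  ext_proj E (r2E (act x u)) = act x (ext_proj E (r2E u)).
Proof. by rewrite /= /to_rv_act /r2E v2rK mod_hom_act. Qed.

Definition to_rv_inj : modHom W (rv_mod to_rv_mod) :=
  mk_hom to_rv_inj_lin to_rv_inj_act.
Definition to_rv_proj : modHom (rv_mod to_rv_mod) V :=
  mk_hom to_rv_proj_lin to_rv_proj_act.

Fact to_rv_inj_ker : lker to_rv_inj = 0%VS.
Proof.
apply: mk_ker => w; rewrite mk_homE => /(congr1 r2E).
by rewrite /r2E v2rK linear0 => /ext_inj_eq0.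
Qed.
Fact to_rv_proj_img : limg to_rv_proj = fullv.
Proof.
apply: mk_img => v; have [u <-] := ext_proj_surj E v.
by exists (v2r u); rewrite mk_homE /r2E v2rK.
Qed.
Fact to_rv_exact : limg to_rv_inj = lker to_rv_proj.
Proof.
apply: mk_exact => [w|u]; rewrite !mk_homE.
  by rewrite /r2E v2rK ext_projK.
move/ext_proj_eq0=> [w uE]; exists w.
by rewrite mk_homE -uE /r2E r2vK.
Qed.

Definition to_rv : rv_extension V W :=
  RvExtension to_rv_inj_ker to_rv_proj_img to_rv_exact.

Lemma to_rv_equiv : ext_equiv E (ext_of_rv to_rv).
Proof.
have lin : linear (fun u : E => v2r u : rv_mod to_rv_mod).
  by move=> c u v; rewrite linearP.
have actf x (u : E) : v2r (act x u) = act x (v2r u : rv_mod to_rv_mod).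
  by rewrite /= /to_rv_act /r2E v2rK.
exists (mk_hom lin actf : modHom E (ext_of_rv to_rv)).
by split=> [w|u]; rewrite !mk_homE // /r2E v2rK.
Qed.

End ToRv.
End SmallExt.

HB.instance Definition _ (K : fieldType) (L : lieAlgType K)
  (V W : lieModule L) := gen_eqMixin (rv_extension V W).
HB.instance Definition _ (K : fieldType) (L : lieAlgType K)
  (V W : lieModule L) := gen_choiceMixin (rv_extension V W).

Section Ext1.
Variables (K : fieldType) (L : lieAlgType K) (V W : lieModule L).

Definition ext_rel (E F : rv_extension V W) : bool :=
  `[< ext_equiv (ext_of_rv E) (ext_of_rv F) >].

Fact ext_rel_refl : reflexive ext_rel.
Proof. by move=> E; apply/asboolP/ext_equiv_refl. Qed.
Fact ext_rel_sym : symmetric ext_rel.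
Proof. by move=> E F; apply/asboolP/asboolP=> /ext_equiv_sym. Qed.
Fact ext_rel_trans : transitive ext_rel.
Proof.
move=> F E G /asboolP EF /asboolP FG; apply/asboolP.
exact: ext_equiv_trans EF FG.
Qed.

Canonical ext_rel_equiv :=
  EquivRel ext_rel ext_rel_refl ext_rel_sym ext_rel_trans.

Definition Ext1 : Type := {eq_quot ext_rel_equiv}.
HB.instance Definition _ := Choice.on Ext1.

Definition ext_class (E : extension V W) : Ext1 :=
  \pi_({eq_quot ext_rel_equiv}) (to_rv E).

Definition ext_repr (c : Ext1) : extension V W :=
  ext_of_rv (repr (c : {eq_quot ext_rel_equiv})).

Lemma ext_classP E F : ext_class E = ext_class F <-> ext_equiv E F.
Proof.
have EP := to_rv_equiv E; have FP := to_rv_equiv F.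
split=> [/eqmodP/asboolP EF | EF].
  exact: ext_equiv_trans (ext_equiv_trans EP EF) (ext_equiv_sym FP).
apply/eqmodP/asboolP.
exact: ext_equiv_trans (ext_equiv_trans (ext_equiv_sym EP) EF) FP.
Qed.

Lemma ext_reprK : cancel ext_repr ext_class.
Proof.
move=> c; rewrite -[RHS](@reprK _ {eq_quot ext_rel_equiv}).
apply/eqmodP/asboolP.
exact: ext_equiv_sym (to_rv_equiv _).
Qed.

Lemma ext_classK (c : Ext1) : exists E, c = ext_class E.
Proof. by exists (ext_repr c); rewrite ext_reprK. Qed.

Definition Ext1_zero : Ext1 := ext_class (split_ext V W).
Definition Ext1_add (c d : Ext1) : Ext1 :=
  ext_class (baer_sum (ext_repr c) (ext_repr d)).
Definition Ext1_scale (a : K) (c : Ext1) : Ext1 :=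
  ext_class (ext_scale a (ext_repr c)).
Definition Ext1_opp (c : Ext1) : Ext1 := Ext1_scale (-1) c.

Lemma ext_repr_equiv E : ext_equiv (ext_repr (ext_class E)) E.
Proof. by apply/ext_classP; rewrite ext_reprK. Qed.

Lemma Ext1_addE E F :
  Ext1_add (ext_class E) (ext_class F) = ext_class (baer_sum E F).
Proof. by apply/ext_classP/baer_sum_equiv; apply: ext_repr_equiv. Qed.

Lemma Ext1_scaleE a E :
  Ext1_scale a (ext_class E) = ext_class (ext_scale a E).
Proof. by apply/ext_classP/ext_scale_equiv; apply: ext_repr_equiv. Qed.

Fact Ext1_addA : associative Ext1_add.
Proof.
move=> c d e; have [E ->] := ext_classK c.
have [F ->] := ext_classK d; have [G ->] := ext_classK e.
have [g1 c1] := ext_cocycle_ex E; have [g2 c2] := ext_cocycle_ex F.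
have [g3 c3] := ext_cocycle_ex G.
rewrite !Ext1_addE; apply/ext_classP.
apply: (ext_equiv_same (baer_cocycle c1 (baer_cocycle c2 c3))
  (baer_cocycle (baer_cocycle c1 c2) c3)) => x v.
exact: addrA.
Qed.

Fact Ext1_addC : commutative Ext1_add.
Proof.
move=> c d; have [E ->] := ext_classK c; have [F ->] := ext_classK d.
have [g1 c1] := ext_cocycle_ex E; have [g2 c2] := ext_cocycle_ex F.
rewrite !Ext1_addE; apply/ext_classP.
apply: (ext_equiv_same (baer_cocycle c1 c2) (baer_cocycle c2 c1)) => x v.
exact: addrC.
Qed.

Fact Ext1_add0 : left_id Ext1_zero Ext1_add.
Proof.
move=> c; have [E ->] := ext_classK c; have [g1 c1] := ext_cocycle_ex E.
rewrite !Ext1_addE; apply/ext_classP.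
apply: (ext_equiv_same (baer_cocycle (split_cocycle V W) c1) c1) => x v.
exact: add0r.
Qed.

Fact Ext1_addN : left_inverse Ext1_zero Ext1_opp Ext1_add.
Proof.
move=> c; have [E ->] := ext_classK c; have [g1 c1] := ext_cocycle_ex E.
rewrite /Ext1_opp Ext1_scaleE Ext1_addE; apply/ext_classP.
apply: (ext_equiv_same (baer_cocycle (scale_cocycle (-1) c1) c1)
  (split_cocycle V W)) => x v.
by rewrite scaleN1r addNr.
Qed.

HB.instance Definition _ :=
  GRing.isZmodule.Build Ext1 Ext1_addA Ext1_addC Ext1_add0 Ext1_addN.

Lemma ext_classD E F : ext_class E + ext_class F = ext_class (baer_sum E F).
Proof. exact: Ext1_addE. Qed.

Fact Ext1_scaleA a b c : Ext1_scale a (Ext1_scale b c) = Ext1_scale (a * b) c.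
Proof.
have [E ->] := ext_classK c; have [g1 c1] := ext_cocycle_ex E.
rewrite !Ext1_scaleE; apply/ext_classP.
apply: (ext_equiv_same (scale_cocycle a (scale_cocycle b c1))
  (scale_cocycle (a * b) c1)) => x v.
by rewrite scalerA.
Qed.

Fact Ext1_scale1 : left_id 1 Ext1_scale.
Proof.
move=> c; have [E ->] := ext_classK c; have [g1 c1] := ext_cocycle_ex E.
rewrite !Ext1_scaleE; apply/ext_classP.
by apply: (ext_equiv_same (scale_cocycle 1 c1) c1) => x v; rewrite scale1r.
Qed.

Fact Ext1_scaleDr : right_distributive Ext1_scale +%R.
Proof.
move=> a c d; have [E ->] := ext_classK c; have [F ->] := ext_classK d.
have [g1 c1] := ext_cocycle_ex E; have [g2 c2] := ext_cocycle_ex F.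
rewrite ext_classD !Ext1_scaleE ext_classD; apply/ext_classP.
apply: (ext_equiv_same (scale_cocycle a (baer_cocycle c1 c2))
  (baer_cocycle (scale_cocycle a c1) (scale_cocycle a c2))) => x v.
exact: scalerDr.
Qed.

Fact Ext1_scaleDl c : {morph Ext1_scale^~ c : a b / a + b}.
Proof.
move=> a b; have [E ->] := ext_classK c; have [g1 c1] := ext_cocycle_ex E.
rewrite !Ext1_scaleE ext_classD; apply/ext_classP.
apply: (ext_equiv_same (scale_cocycle (a + b) c1)
  (baer_cocycle (scale_cocycle a c1) (scale_cocycle b c1))) => x v.
exact: scalerDl.
Qed.

HB.instance Definition _ := GRing.Zmodule_isLmodule.Build K Ext1
  Ext1_scaleA Ext1_scale1 Ext1_scaleDr Ext1_scaleDl.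

Lemma ext_classZ a E : a *: ext_class E = ext_class (ext_scale a E).
Proof. exact: Ext1_scaleE. Qed.

End Ext1.

Definition has_dim (K : fieldType) (M : lmodType K) (n : nat) : Prop :=
  exists2 f : M -> 'rV[K]_n, linear f & bijective f.

(* Main.v *)
Require Import Defs.
From HB Require Import structures.
From mathcomp Require Import all_boot all_order all_algebra.
From mathcomp Require Import all_classical all_reals.
From mathcomp Require Import complex.
From mathcomp Require Import ring.

Set Implicit Arguments.
Unset Strict Implicit.
Unset Printing Implicit Defensive.

Import Order.TTheory GRing.Theory Num.Theory.
Local Open Scope classical_set_scope.
Local Open Scope ring_scope.

(* An irreducible V is annihilated by g (x) I, where I is the ideal of        *)
(* polynomials vanishing on some finite set S: the annihilator contains some  *)
(* g (x) (p), p <> 0, and nilpotent ideals act by 0. Hence so is              *)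
(* M = V^* (x) V'. A 1-cocycle c : g[t] -> M vanishes on g (x) I^2, and its   *)
(* restriction to g (x) (I / I^2), a sum of the modules g(ad, a ad), a in S,  *)
(* is a family of morphisms phi_a. Subtracting the cocycles                   *)
(* x (x) f |-> f'(a) phi_a(x) from c leaves a cocycle of the semisimple       *)
(* algebra g (x) C[t] / I, which is a coboundary by Whitehead's lemma. Thus   *)
(* Ext^1(V, V') = H^1(g[t], M) is the sum over a of Hom(g(ad, a ad), M); the  *)
(* other assertions follow from Schur's lemma.                                *)
(* Whitehead's lemma rests on Cartan's criterion; the semisimple part of an   *)
(* operator enters only through its complex conjugate, a polynomial r(X)      *)
(* with r(a) = a^* on the spectrum of X, for which tr(r(X) X) is the sum of   *)
(* the |a|^2.                                                                 *)

(** * Polynomial interpolation and nilpotent matrices *)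

(** After the choice of a linear section, an extension of [V] by [V'] amounts to a 1-cocycle of g[t]
    with values in M = [tens_mod (dual_mod V) V'], and equivalent extensions amount to cohomologous
    cocycles ([represents_cocycle], [cocycle_extension], [represents_eq]). Everything thus reduces
    to H^1(g[t], M).

    This is tractable because an irreducible module only sees the values of polynomials on a finite
    set s ([irreducible_supported]). If I is the ideal of polynomials vanishing on s, then g (x) I
    acts on M by zero, so a cocycle kills [g (x) I, g (x) I] = g (x) I^2 ([cocycle_jet_eq]): only
    values and first derivatives at the points of s matter. The derivatives at a contribute a
    morphism from [eval_mod g a] to M, which is arbitrary and determined by the class; the values
    contribute only coboundaries, because g (x) C[t]/I is semisimple ([whitehead]). This is the
    content of [cocycle_decomposition] and [cocycle_decomposition_unique]. [Ext1_dim] turns it into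
    a dimension, and by [homs_eval_out] points outside s contribute nothing.

    For a trivial first argument M is the other module, and Schur's lemma leaves at most one nonzero
    summand, of dimension 1 ([Ext1_triv_eval]). For V = V' the action on V itself supplies a nonzero
    morphism as soon as V is nontrivial ([homs_eval_End]). For V trivial Ext^1(V, V) is zero, g
    being perfect, so the last assertion concerns nontrivial V. *)

Lemma coprimep_prod_XsubC_exp (K : fieldType) (s : seq K) N (a : K) :
  a \notin s ->
  coprimep (\prod_(b <- s) ('X - b%:P) ^+ N) (('X - a%:P) ^+ N).
Proof.
move=> as_; apply: coprimep_expr; elim: s as_ => [|b s IHs].
  by rewrite big_nil coprime1p.
rewrite inE negb_or big_cons coprimepMl => /andP[ab as_].
by rewrite IHs // andbT coprimep_expl // coprimep_XsubC root_XsubC.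
Qed.

Lemma prod_XsubC_exp_dvdp (K : fieldType) (s : seq K) N (q : {poly K}) :
    uniq s -> (forall a, a \in s -> ('X - a%:P) ^+ N %| q) ->
  \prod_(a <- s) ('X - a%:P) ^+ N %| q.
Proof.
elim: s => [|a s IHs] /=; first by rewrite big_nil dvd1p.
move=> /andP[as_ us] dvq; rewrite big_cons.
rewrite Gauss_dvdp ?dvq ?mem_head //=; last first.
  by rewrite coprimep_sym coprimep_prod_XsubC_exp.
by apply: IHs => // b bs; apply: dvq; rewrite inE bs orbT.
Qed.

Lemma prod_XsubC_dvdp_exp (K : fieldType) (s : seq K) (m : {poly K}) :
    (forall a, a \in s -> 'X - a%:P %| m) ->
  \prod_(a <- s) ('X - a%:P) %| m ^+ size s.
Proof.
elim: s => [|a s IHs] dvm; first by rewrite big_nil dvd1p.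
rewrite big_cons exprS dvdp_mul ?dvm ?mem_head //.
by apply: IHs => b bs; apply: dvm; rewrite inE bs orbT.
Qed.

(** Chinese remaindering: by Bezout [u * m] is 0 modulo the (X - b)^N with b in [s] and 1 modulo (X
    - a)^N, so it carries the correction at the new point a. Congruence to order [N], beyond
    equality of values, makes q(X) scalar on generalized eigenspaces. *)
Lemma poly_interp (K : fieldType) (s : seq K) (N : nat) (v : K -> K) :
  uniq s ->
  exists q : {poly K}, forall a, a \in s -> ('X - a%:P) ^+ N %| q - (v a)%:P.
Proof.
elim: s => [|a s IHs] /=; first by exists 0.
move=> /andP[as_ us]; have [q qP] := IHs us.
pose m : {poly K} := \prod_(b <- s) ('X - b%:P) ^+ N.
have dvm b : b \in s -> ('X - b%:P) ^+ N %| m.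
  by move=> bs; rewrite /m (big_rem b) //= dvdp_mulr.
have /Bezout_eq1_coprimepP[[u w] /= uw] := coprimep_prod_XsubC_exp N as_.
exists (q + ((v a)%:P - q) * (u * m)) => b; rewrite inE => /orP[/eqP ->|bs].
  have -> : u * m = 1 - w * ('X - a%:P) ^+ N by rewrite -uw addrK.
  have -> : q + ((v a)%:P - q) * (1 - w * ('X - a%:P) ^+ N) - (v a)%:P =
     (q - (v a)%:P) * w * ('X - a%:P) ^+ N by ring.
  exact: dvdp_mull.
by rewrite addrAC dvdp_addr ?qP // !dvdp_mull // dvm.
Qed.

Section Nilpotency.
Variable C : numClosedFieldType.

Lemma trig_mulmx n (A B : 'M[C]_n) : is_trig_mx A -> is_trig_mx B ->
  is_trig_mx (A *m B) /\ forall i, (A *m B) i i = A i i * B i i.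
Proof.
move=> /is_trig_mxP tA /is_trig_mxP tB; split=> [|i].
  apply/is_trig_mxP => i j ij; rewrite mxE big1 // => k _.
  have [ik|ki] := ltnP i k; first by rewrite tA ?mul0r.
  by rewrite (tB k j) ?mulr0 ?(leq_ltn_trans ki).
rewrite mxE (bigD1 i) //= big1 ?addr0 // => k ki.
have [ik|ik|/val_inj ik] := ltngtP i k; first by rewrite tA ?mul0r.
  by rewrite tB ?mulr0.
by rewrite ik eqxx in ki.
Qed.

Lemma trig_horner n (A : 'M[C]_n.+1) (p : {poly C}) : is_trig_mx A ->
  is_trig_mx (horner_mx A p) /\ forall i, horner_mx A p i i = p.[A i i].
Proof.
move=> tA; elim/poly_ind: p => [|p c [IHt IHd]].
  rewrite rmorph0 mx0_is_trig; split=> // i; by rewrite mxE horner0.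
rewrite rmorphD rmorphM /= horner_mx_X horner_mx_C.
have [tM dM] := trig_mulmx IHt tA; split=> [|i].
  apply/is_trig_mxP => i j ij; rewrite mxE.
  by rewrite (is_trig_mxP tM) // (is_trig_mxP (scalar_mx_is_trig _ c)) ?addr0.
by rewrite mxE dM IHd !hornerE mxE eqxx mulr1n.
Qed.

(* Since [r.[a] = a^*] on the spectrum, the trace is the sum of the           *)
(* [a * a^* = `|a|^2] over the eigenvalues.                                   *)
Lemma nilpotent_trace n (X : 'M[C]_n.+1) (r : {poly C}) :
    (forall a, eigenvalue X a -> r.[a] = Num.conj a) ->
  \tr (horner_mx X r *m X) = 0 -> X ^+ n.+1 = 0.
Proof.
move=> rP; have [//|P Pu] := @Schur _ _ X _; rewrite /similar_to /= => tT.
have {}Pu : P \in unitmx by exact: unitarymx_unit.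
set T := conjmx P X in tT.
have TE : T = P *m X *m invmx P by rewrite /T conjumx.
have hT (p : {poly C}) : horner_mx T p = P *m horner_mx X p *m invmx P.
  by rewrite TE horner_mx_uconj.
have -> : \tr (horner_mx X r *m X) = \tr (horner_mx T r *m T).
  by rewrite hT TE !mulmxA mulmxKV // [RHS]mxtrace_mulC !mulmxA mulVmx //
    mul1mx.
have [tr dr] := trig_horner r tT; have [_ dM] := trig_mulmx tr tT.
have ev i : eigenvalue T (T i i).
  rewrite eigenvalue_root_char char_poly_trig // /root horner_prod.
  by rewrite (bigD1 i) //= !hornerE subrr mul0r.
have evX i : eigenvalue X (T i i).
  apply: (@eigenvalue_conjmx _ _ _ P X); last exact: ev.
    exact: stablemx_unit.
  by rewrite row_free_unit.
rewrite /mxtrace => tr0.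
have T0 i : T i i = 0.
  have : \sum_i T i i * (T i i)^* = 0.
    rewrite -[RHS]tr0; apply: eq_bigr => j _.
    by rewrite dM dr rP // mulrC.
  move/eqP; rewrite psumr_eq0 => [/allP/(_ i)|j _]; last exact: mul_conjC_ge0.
  by rewrite mem_index_enum mul_conjC_eq0 => /(_ isT)/eqP.
(* With zero diagonal, the characteristic polynomial of [T] is X^(n+1). *)
have Tn : T ^+ n.+1 = 0.
  have := Cayley_Hamilton T; rewrite char_poly_trig //.
  under eq_bigr do rewrite T0 subr0.
  by rewrite prodr_const card_ord rmorphXn /= horner_mx_X.
have := hT ('X^(n.+1)); rewrite !rmorphXn /= !horner_mx_X Tn.
move=> /(congr1 (fun Z => invmx P *m Z *m P)).
by rewrite mulmx0 mul0mx !mulmxA mulVmx // mul1mx mulmxKV.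
Qed.

End Nilpotency.

(** * Polynomials in a linear operator *)

Section PolyApply.
Variables (K : fieldType) (M : lmodType K) (f : M -> M).
Hypothesis lin_f : linear f.
Implicit Types (p q : {poly K}) (u : M).

Definition poly_apply (q : {poly K}) (u : M) : M :=
  \sum_(i < size q) q`_i *: iter i f u.

Lemma poly_applyE n q u : (size q <= n)%N ->
  poly_apply q u = \sum_(i < n) q`_i *: iter i f u.
Proof.
move=> le_n; rewrite /poly_apply (big_ord_widen n (fun i =>
  q`_i *: iter i f u)) //.
rewrite big_mkcond; apply: eq_bigr => i _; case: ltnP => // /(nth_default 0) ->.
by rewrite scale0r.
Qed.

Lemma iter_linear i : linear (iter i f).
Proof. by elim: i => [|i IHi] a u v //; rewrite !iterS (IHi a u v) (lin_f a).
  Qed.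

Lemma poly_apply_linear q : linear (poly_apply q).
Proof.
move=> a u v; rewrite /poly_apply scaler_sumr -big_split; apply: eq_bigr => i _.
by rewrite (iter_linear i a) scalerDr !scalerA mulrC.
Qed.

Lemma poly_applyD p q u : poly_apply (p + q) u = poly_apply p u + poly_apply q
  u.
Proof.
have le1 := leq_maxl (size p) (size q); have le2 := leq_maxr (size p) (size q).
rewrite (poly_applyE u (size_polyD p q)) (poly_applyE u le1) (poly_applyE u
  le2).
by rewrite -big_split; apply: eq_bigr => i _; rewrite coefD scalerDl.
Qed.

Lemma poly_applyC a u : poly_apply a%:P u = a *: u.
Proof.
by rewrite (poly_applyE u (size_polyC_leq1 a)) big_ord1 coefC.
Qed.

Lemma poly_applyZ a q u : poly_apply (a *: q) u = a *: poly_apply q u.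
Proof.
rewrite (poly_applyE u (size_scale_leq a q)) scaler_sumr.
by apply: eq_bigr => i _; rewrite coefZ scalerA.
Qed.

Lemma poly_applyMX q u : poly_apply (q * 'X) u = poly_apply q (f u).
Proof.
have le_q : (size (q * 'X)%R <= (size q).+1)%N.
  by rewrite (leq_trans (size_polyMleq _ _)) // size_polyX addn2.
rewrite (poly_applyE u le_q) big_ord_recl coefMX scale0r add0r.
by apply: eq_bigr => i _; rewrite coefMX /= -iterS iterSr.
Qed.

Lemma poly_applyMXsubC q c u :
  poly_apply (q * ('X - c%:P)) u = poly_apply q (f u - c *: u).
Proof.
rewrite mulrBr [q * c%:P]mulrC mul_polyC -scaleNr poly_applyD poly_applyMX.
rewrite poly_applyZ [f u - _]addrC -scaleNr.
by rewrite (poly_apply_linear q (- c)) addrC.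
Qed.

(** Write q = v + w (X - c)^N: the factor (f - c)^N kills [u], which leaves the scalar v. *)
Lemma poly_apply_eigen q c v N u :
    ('X - c%:P) ^+ N %| q - v%:P -> iter N (fun w => f w - c *: w) u = 0 ->
  poly_apply q u = v *: u.
Proof.
move=> /dvdpP[w qE] u0; rewrite -[q](subrK v%:P) qE poly_applyD poly_applyC.
suff -> : poly_apply (w * ('X - c%:P) ^+ N) u = 0 by rewrite add0r.
elim: N {qE} u u0 => [|N IHN] u.
  by move=> /= ->; rewrite (plin0 (poly_apply_linear _)).
rewrite iterSr exprSr mulrA poly_applyMXsubC; exact: IHN.
Qed.

Lemma poly_apply_closed (P : M -> Prop) q u :
    P 0 -> (forall a v w, P v -> P w -> P (a *: v + w)) ->
    (forall v, P v -> P (f v)) ->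
  P u -> P (poly_apply q u).
Proof.
move=> P0 PL Pf Pu; rewrite /poly_apply; elim/big_rec: _ => // i v _; apply: PL.
by elim: (nat_of_ord i) => //= k; apply: Pf.
Qed.

End PolyApply.

Section AdPoly.
Variable C : numClosedFieldType.

Definition mx_ad n (X Y : 'M[C]_n) : 'M[C]_n := X *m Y - Y *m X.

Lemma mx_ad_linear n (X : 'M[C]_n) : linear (mx_ad X).
Proof.
move=> a Y Z; rewrite /mx_ad mulmxDr mulmxDl -scalemxAr -scalemxAl.
by rewrite scalerBr opprD addrACA.
Qed.

(** The operator ad X - (b - a) is the difference of two commuting ones, left multiplication by X -
    b and right multiplication by X - a. Each term of the binomial expansion of its power i + j has
    i factors of the first kind or j of the second; the induction on i + j replaces that
    expansion. *)
Lemma iter_mx_ad n (X Y : 'M[C]_n.+1) a b i j :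
    (X - b%:M) ^+ i *m Y = 0 -> Y *m (X - a%:M) ^+ j = 0 ->
  iter (i + j) (fun Z => mx_ad X Z - (b - a) *: Z) Y = 0.
Proof.
set D := fun Z => _.
have linD : linear D.
  move=> c Z Z'; rewrite /D (mx_ad_linear X c).
  move: (mx_ad X Z) (mx_ad X Z') => U U'.
  by rewrite scalerBr scalerDr !scalerA [c * _]mulrC opprD addrACA.
move: {2}(i + j)%N (erefl (i + j)%N) => k; elim: k i j Y => [|k IHk] i j Y.
  by move/eqP; rewrite addn_eq0 => /andP[/eqP -> /eqP ->]; rewrite mul1mx.
have l0 := plin0 (iter_linear linD _); case: i => [|i].
  by move=> _; rewrite mul1mx => -> _.
case: j => [|j]; first by move=> _ _; rewrite mulmx1 => ->.
rewrite addSn => -[ijk] XY YX; rewrite iterSr.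
have -> : D Y = (X - b%:M) *m Y - Y *m (X - a%:M).
  rewrite /D /mx_ad mulmxBl mulmxBr mul_scalar_mx mul_mx_scalar scalerBl.
  by rewrite !opprB addrACA addrA [in RHS]addrAC -!addrA; congr (_ + _);
    rewrite addrCA.
rewrite (plinB (iter_linear linD _)) (IHk i j.+1) // 1?addnS -1?addSn 1?(IHk
  i.+1 j) ?subrr //.
- by rewrite addSnnS.
- by rewrite mulmxA XY mul0mx.
- by rewrite -mulmxA mulmxE -exprS -mulmxE.
- by rewrite mulmxA mulmxE -exprSr -mulmxE.
- by rewrite -mulmxA YX mulmx0.
Qed.

(* With [r] agreeing with conjugation on the spectrum of [X] and [q] agreeing *)
(* with conjugation on the differences of eigenvalues (both to high order),   *)
(* [[r(X), Y]] is [q(ad X) Y]: on the component of [Y] mapping the [a]- to    *)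
(* the [b]-generalized eigenspace both multiply by [b^* - a^*].               *)
Lemma conj_poly_ad n (X : 'M[C]_n.+1) : exists r : {poly C},
  (forall a, eigenvalue X a -> r.[a] = Num.conj a) /\
  forall P : 'M[C]_n.+1 -> Prop,
    P 0 -> (forall a Y Z, P Y -> P Z -> P (a *: Y + Z)) ->
    (forall Y, P Y -> P (mx_ad X Y)) ->
  forall Y, P Y -> P (mx_ad (horner_mx X r) Y).
Proof.
have [rs chX] := closed_field_poly_normal (char_poly X).
rewrite (monicP (char_poly_monic X)) scale1r in chX.
pose N := (size rs).+1; pose s := undup rs; have us : uniq s := undup_uniq rs.
pose m : {poly C} := \prod_(a <- s) ('X - a%:P) ^+ N.
have mX0 p : m %| p -> horner_mx X p = 0.
  move=> /(dvdp_trans _) dvp; have : char_poly X %| p.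
    apply: dvp; rewrite chX /m prodrXl exprS; apply: dvdp_mull.
    apply: prod_XsubC_dvdp_exp => a ars.
    by rewrite (big_rem a) ?mem_undup //= dvdp_mulr.
  by case/dvdpP=> w ->; rewrite rmorphM /= Cayley_Hamilton mulr0.
have [r rP] := poly_interp N (fun a => Num.conj a) us.
pose ds := undup [seq b - a | b <- s, a <- s].
(* One [q] serves all pairs (b, a) because b^* - a^* depends only on b - a. The order N + N is the
   power of ad X - (b - a) that [iter_mx_ad] needs. *)
have [q qP] := poly_interp (N + N) (fun a =>
  Num.conj a) (undup_uniq _ : uniq ds).
(* [e b] evaluated at X, called [E b] below, is the projector onto the generalized eigenspace of b;
   the blocks [E b *m Y *m E a] of Y are generalized eigenvectors of ad X for b - a. *)
pose e b := sval (cid (poly_interp N (fun a => (a == b)%:R) us)).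
have eP a b : a \in s -> ('X - a%:P) ^+ N %| e b - ((a == b)%:R)%:P.
  by move=> as_; rewrite /e; case: cid => /= w; apply.
exists r; split=> [a|P P0 PL PX Y PY].
  rewrite eigenvalue_root_char chX root_prod_XsubC -mem_undup => as_.
  have /dvdpP[w /eqP] := rP a as_; rewrite subr_eq => /eqP ->.
  by rewrite !hornerE subrr expr0n mulr0 add0r.
suff -> : mx_ad (horner_mx X r) Y = poly_apply (mx_ad X) q Y.
  exact: poly_apply_closed.
have eM b : b \in s -> m %| ('X - b%:P) ^+ N * e b.
  move=> bs; apply: prod_XsubC_exp_dvdp => // a as_.
  have [->|ab] := eqVneq a b; first exact: dvdp_mulr.
  by apply: dvdp_mull; have := eP a b as_; rewrite (negPf ab) subr0.
pose E b := horner_mx X (e b).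
have sumE : \sum_(b <- s) E b = 1.
  apply/eqP; rewrite -subr_eq0 -(rmorph1 (horner_mx X)) -rmorph_sum -rmorphB /=.
  apply/eqP/mX0/prod_XsubC_exp_dvdp => // a as_.
  rewrite (bigD1_seq a) //= addrAC dvdp_addr.
    apply: (big_ind (fun p => _ %| p)) => [||b ba]; first exact: dvdp0.
      by move=> u w; apply: dvdp_add.
    by have := eP a b as_; rewrite eq_sym (negPf ba) subr0.
  by have := eP a a as_; rewrite eqxx.
have hXa a : horner_mx X (('X - a%:P) ^+ N) = (X - a%:M) ^+ N.
  by rewrite rmorphXn rmorphB /= horner_mx_X horner_mx_C.
have XE b : b \in s -> (X - b%:M) ^+ N *m E b = 0.
  by move=> bs; rewrite -hXa; have := mX0 _ (eM b bs); rewrite rmorphM.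
have EX b : b \in s -> E b *m (X - b%:M) ^+ N = 0.
  by move=> bs; rewrite -hXa; have := mX0 _ (eM b bs); rewrite mulrC rmorphM.
have hr b : b \in s -> horner_mx X r *m E b = Num.conj b *: E b /\
                       E b *m horner_mx X r = Num.conj b *: E b.
  move=> bs; have /dvdpP[w /eqP] := rP b bs; rewrite subr_eq => /eqP ->.
  rewrite rmorphD rmorphM /= horner_mx_C hXa mulmxDl mulmxDr.
  rewrite mul_scalar_mx mul_mx_scalar.
  rewrite -mulmxE -mulmxA XE // mulmx0 add0r -hXa mulmxE.
  rewrite (comm_horner_mx2 X w _) mulrA -mulmxE hXa EX //.
  by rewrite mul0mx add0r.
have -> : Y = \sum_(b <- s) \sum_(a <- s) E b *m Y *m E a.
  under eq_bigr do rewrite -mulmx_sumr sumE mulmx1.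
  by rewrite -mulmx_suml sumE mul1mx.
rewrite (plin_sum (mx_ad_linear _)) (plin_sum (poly_apply_linear (mx_ad_linear
  X) q)).
rewrite big_seq [RHS]big_seq; apply: eq_bigr => b bs.
rewrite (plin_sum (mx_ad_linear _)) (plin_sum (poly_apply_linear (mx_ad_linear
  X) q)).
rewrite big_seq [RHS]big_seq; apply: eq_bigr => a as_.
rewrite (@poly_apply_eigen _ _ _ (mx_ad_linear X) q (b - a) (Num.conj (b - a))
  (N + N)).
- have [hb _] := hr b bs; have [_ ha] := hr a as_.
  rewrite /mx_ad !mulmxA hb -(mulmxA (E b *m Y) (E a)) ha.
  by rewrite -!scalemxAl -scalemxAr -scalerBl rmorphB.
- by apply: qP; rewrite mem_undup; apply/allpairsP; exists (b, a).
- apply: iter_mx_ad; first by rewrite !mulmxA XE ?mul0mx.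
  by rewrite -(mulmxA _ (E a)) EX ?mulmx0.
Qed.

End AdPoly.

(** * Engel's theorem and Cartan's criterion *)

Section SimpleLie.
Variables (K : fieldType) (g : finLieAlgType K).

Lemma simple_ideal (P : g -> Prop) : simple_lie g ->
    P 0 -> (forall a x y, P x -> P y -> P (a *: x + y)) ->
    (forall x y, P y -> P (lie x y)) ->
  (forall x, P x -> x = 0) \/ (forall x, P x).
Proof.
move=> [_ simp] P0 PL PI; have [I IP] := vspace_of_pred P0 PL.
have [x y|I0|If] := simp I; first by rewrite !IP; apply: PI.
  by left=> x /IP; rewrite I0 memv0 => /eqP.
by right=> x; apply/IP; rewrite If memvf.
Qed.

(** Such a [P] is an ideal containing all brackets, hence nonzero, hence g. This is [g, g] = g in
    the form of an induction principle: a linear property need only be checked on brackets. *)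
Lemma lie_perfect_ind (P : g -> Prop) : simple_lie g ->
    P 0 -> (forall a x y, P x -> P y -> P (a *: x + y)) ->
  (forall x y, P (lie x y)) -> forall x, P x.
Proof.
move=> g_simple P0 PL Pl; have [Pz|//] := simple_ideal g_simple P0 PL (fun x y
  _ => Pl x y).
by have [[x [y]]] := g_simple; rewrite (Pz _ (Pl x y)) eqxx.
Qed.

(* A subalgebra [k] all of whose invariant subspaces [W != g] admit a         *)
(* [k]-invariant vector in [g / W] can be enlarged by any [x] normalizing it. *)
Lemma engel_center : (exists x : g, x != 0) ->
    (forall x y : g, exists n, iter n (lie x) y = 0) ->
  exists2 v : g, v != 0 & forall x, lie x v = 0.
Proof.
move=> [x0 x0_nz] nil.
pose good (k : {vspace g}) :=
  (forall x y, x \in k -> y \in k -> lie x y \in k) /\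
  forall W : {vspace g}, (forall x w, x \in k -> w \in W -> lie x w \in W) ->
    W != fullv -> exists2 v, v \notin W & forall x, x \in k -> lie x v \in W.
have notin (W : {vspace g}) : W != fullv -> exists v, v \notin W.
  move=> Wf; have : ~~ (fullv <= W)%VS.
    by apply: contra Wf => fW; rewrite eqEsubv subvf.
  by case/subvPn=> v _ vW; exists v.
have step k : good k -> k != fullv ->
    exists2 k' : {vspace g}, good k' & (\dim k < \dim k')%N.
  (* Taking [W = k] yields an x outside k that normalizes k. *)
  move=> [kk kW] kf; have [x xk xN] := kW k kk kf.
  exists (k + <[x]>)%VS; last first.
    rewrite ltn_neqAle (dimvS (addvSl _ _)) andbT; apply: contra xk => /eqP eqd.
    suff ->: k = (k + <[x]>)%VS by rewrite memvE addvSr.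
    by apply/eqP; rewrite eqEdim addvSl eqd leqnn.
  have lN y : y \in k -> lie x y \in k by move=> yk; rewrite lieC memvN xN.
  split=> [y z /memv_addP[y' y'k [_ /vlineP[a ->] ->]]|W kxW Wf].
    case/memv_addP=> z' z'k [_ /vlineP[b ->] ->].
    apply: subvP (addvSl k _) _ _.
    rewrite (plinD (lie_linearl _)) !(plinD (lie_linearr _)).
    rewrite !(plinZ (lie_linearl _)) !(plinZ (lie_linearr _)) liexx !scaler0
      addr0.
    by rewrite !memvD // ?memvZ ?xN ?lN ?kk.
  have kx_k y : y \in k -> y \in (k + <[x]>)%VS by apply: subvP (addvSl _ _) _.
  have xx : x \in (k + <[x]>)%VS by rewrite memvE addvSr.
  have [|v vW kv] := kW W _ Wf; first by move=> y w /kx_k; apply: kxW.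
  have exn : exists n, iter n (lie x) v \in W.
    by have [n nv] := nil x v; exists n; rewrite nv mem0v.
  (* The last iterate of ad x on v outside W is killed modulo W by x; it is still killed by k, since
     x normalizes k. *)
  have [m mW m_min] := ex_minnP exn.
  have kiter i y : y \in k -> lie y (iter i (lie x) v) \in W.
    elim: i y => [|i IHi] y yk; first exact: kv.
    rewrite iterS.
    have -> : lie y (lie x (iter i (lie x) v)) =
      lie x (lie y (iter i (lie x) v)) - lie (lie x y) (iter i (lie x) v).
      by rewrite lie_leibniz opprB addrC subrK.
    by rewrite memvB ?IHi ?lN // kxW ?IHi.
  case: m mW m_min => [|m] mW m_min; first by rewrite (negPf vW) in mW.
  exists (iter m (lie x) v); first by apply/negP => /m_min; rewrite ltnn.
  move=> _ /memv_addP[y yk [_ /vlineP[a ->] ->]].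
  rewrite (plinD (lie_linearl _)) (plinZ (lie_linearl _)).
  by apply: memvD; [apply: kiter | apply: memvZ].
have goodf : good fullv.
  have [d] : {d | (\dim {:g} - \dim (0%VS : {vspace g}) <= d)%N}
    by exists (\dim {:g} - \dim (0%VS : {vspace g}))%N.
  have : good 0%VS.
    split=> [x y|W _ /notin[v vW]].
      by rewrite !memv0 => /eqP -> _; rewrite (plin0 (lie_linearl _)).
    by exists v => // x; rewrite memv0 => /eqP ->;
      rewrite (plin0 (lie_linearl _)) mem0v.
  elim: d (0%VS : {vspace g}) => [|d IHd] k gk le_d.
    suff <- : k = fullv by [].
    by apply/eqP; rewrite eqEdim subvf /= -subn_eq0 -leqn0.
  have [<- //|kf] := eqVneq k fullv; have [k' gk' lt_k] := step k gk kf.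
  apply: (IHd k' gk'); rewrite -ltnS (leq_trans _ le_d) // ltn_sub2l //.
  by rewrite (leq_trans lt_k) // dimvS ?subvf.
have [||v v0 vP] := goodf.2 0%VS.
- by move=> x w _; rewrite !memv0 => /eqP ->; rewrite (plin0 (lie_linearr _)).
- by apply: contra x0_nz => /eqP z; rewrite -memv0 z memvf.
exists v; first by rewrite -memv0.
by move=> x; apply/eqP; rewrite -memv0 vP ?memvf.
Qed.

End SimpleLie.

Section TraceForm.
Variable C : numClosedFieldType.

Lemma mxtrace_ad n (A Y Z : 'M[C]_n) :
  \tr (A *m mx_ad Y Z) = \tr (mx_ad A Y *m Z).
Proof.
rewrite /mx_ad mulmxBr mulmxBl !linearB /= !mulmxA; congr (_ - _).
by rewrite [LHS]mxtrace_mulC mulmxA.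
Qed.

(** A polynomial in X commutes with whatever X commutes with, so r(X), with r the conjugation on the
    spectrum, is an admissible [A]. *)
Lemma nilpotent_comm n (X : 'M[C]_n) :
    (forall A : 'M_n, (forall Y, comm_mx X Y -> comm_mx A Y) -> \tr (A *m X) =
      0) ->
  X ^+ n = 0.
Proof.
case: n X => [|n] X trX; first exact: flatmx0.
have [r [rP _]] := conj_poly_ad X; apply: (nilpotent_trace rP).
by apply: trX => Y; apply: comm_horner_mx.
Qed.

(** Otherwise [rho] is injective. Then tr(r(X) [y, z]) = tr([r(X), y] z) = 0 for X = rho(x), since
    [r(X), rho(y)] stays in rho(g) by [conj_poly_ad]; as g is perfect, tr(r(X) X) = 0 and X is
    nilpotent. So every ad x is nilpotent, and Engel's theorem gives a nonzero center, impossible in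
    a simple algebra. *)
Lemma cartan_trace (g : finLieAlgType C) n (rho : g -> 'M[C]_n) :
    simple_lie g -> linear rho ->
    (forall x y, rho (lie x y) = mx_ad (rho x) (rho y)) ->
    (forall x y, \tr (rho x *m rho y) = 0) ->
  forall x, rho x = 0.
Proof.
case: n rho => [|n] rho g_simple lin_rho rho_lie tr0; first by move=> x;
  apply: flatmx0.
have [] // := @simple_ideal _ g (fun x => rho x = 0) g_simple.
- exact: plin0.
- by move=> a x y x0 y0; rewrite (lin_rho a) x0 y0 scaler0 addr0.
- by move=> x y y0; rewrite rho_lie y0 (plin0 (mx_ad_linear _)).
move=> rho_inj.
have nil x : rho x ^+ n.+1 = 0.
  have [r [rP adP]] := conj_poly_ad (rho x); apply: (nilpotent_trace rP).
  pose Q y := \tr (horner_mx (rho x) r *m rho y) = 0.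
  apply: (@lie_perfect_ind _ _ Q) => //= [|a y z Qy Qz|y z]; rewrite /Q.
  - by rewrite (plin0 lin_rho) mulmx0 mxtrace0.
  - by rewrite (lin_rho a) mulmxDr -scalemxAr mxtraceD mxtraceZ Qy Qz mulr0
      addr0.
  rewrite rho_lie mxtrace_ad.
  have [||||y' ->] := adP (fun Y => exists y, Y = rho y) _ _ _ (rho y).
  - by exists 0; rewrite (plin0 lin_rho).
  - by move=> a _ _ [u ->] [v ->]; exists (a *: u + v); rewrite (lin_rho a).
  - by move=> _ [u ->]; exists (lie x u); rewrite rho_lie.
  - by exists y.
  exact: tr0.
have [[x0 [y0 xy0]] _] := g_simple.
have [||v v0 vP] := @engel_center _ g.
- by exists (lie x0 y0).
- move=> x y; exists (n.+1 + n.+1)%N; apply: rho_inj.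
  have -> m : rho (iter m (lie x) y) = iter m (mx_ad (rho x)) (rho y).
    by elim: m => //= m IHm; rewrite rho_lie IHm.
  have := @iter_mx_ad _ _ (rho x) (rho y) 0 0 n.+1 n.+1.
  rewrite raddf0 !subr0 nil mul0mx mulmx0 => /(_ erefl erefl) h0.
  by rewrite -[RHS]h0; apply: eq_iter => Z; rewrite scale0r subr0.
have [||//|cen|cen] := @simple_ideal _ g (fun v =>
  forall x, lie x v = 0) g_simple.
- by move=> x; rewrite (plin0 (lie_linearr x)).
- by move=> a u w u0 w0 x; rewrite (lie_linearr x a) u0 w0 scaler0 addr0.
- by move=> x y yP z; rewrite yP (plin0 (lie_linearr z)).
- by case/eqP: v0; apply: cen.
by rewrite cen eqxx in xy0.
Qed.

End TraceForm.

Section EndMatrix.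
Variables (K : fieldType) (M : vectType K).
Local Notation b := (vbasis {:M}).

(** Columns, not rows, hold the images of the basis vectors, so that composition becomes the product
    in the same order. *)
Definition end_mx (f : M -> M) : 'M[K]_(\dim {:M}) :=
  \matrix_(i, j) coord b i (f b`_j).

Lemma end_mxM (f h : M -> M) : linear f ->
  end_mx (fun v => f (h v)) = end_mx f *m end_mx h.
Proof.
move=> lin_f; apply/matrixP=> i j; rewrite !mxE {1}(coord_vbasis (memvf (h
  b`_j))).
rewrite (plin_sum lin_f) linear_sum; apply: eq_bigr => k _.
by rewrite !mxE (plinZ lin_f) linearZ /= mulrC.
Qed.

Lemma end_mxP a (f h : M -> M) :
  end_mx (fun v => a *: f v + h v) = a *: end_mx f + end_mx h.
Proof. by apply/matrixP=> i j; rewrite !mxE linearP. Qed.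

Lemma end_mx_ext (f h : M -> M) : f =1 h -> end_mx f = end_mx h.
Proof. by move=> fh; apply/matrixP=> i j; rewrite !mxE fh. Qed.

Lemma end_mx_id : end_mx id = 1%:M.
Proof.
by apply/matrixP=> i j; rewrite !mxE coord_free ?(basis_free (vbasisP _)) //
  eq_sym.
Qed.

Lemma end_mx_inj (f h : M -> M) : linear f -> linear h ->
  end_mx f = end_mx h -> f =1 h.
Proof.
move=> lin_f lin_h /matrixP fh v; rewrite (coord_vbasis (memvf v)).
rewrite (plin_sum lin_f) (plin_sum lin_h); apply: eq_bigr => j _.
rewrite (plinZ lin_f) (plinZ lin_h); congr (_ *: _).
rewrite (coord_vbasis (memvf (f _))) (coord_vbasis (memvf (h _))).
by apply: eq_bigr => i _; have := fh i j; rewrite !mxE => ->.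
Qed.

Lemma end_mx_iter (f : M -> M) k : linear f -> end_mx (iter k f) = end_mx f ^+
  k.
Proof.
move=> lin_f; elim: k => [|k IHk]; first exact: end_mx_id.
by rewrite exprS -mulmxE -IHk -end_mxM.
Qed.

End EndMatrix.

(** * Support of an irreducible module *)

Section CommonKernel.
Variables (K : fieldType) (M : vectType K) (I : Type) (F : I -> M -> M).
Hypotheses (lin_F : forall i, linear (F i))
           (commF : forall i j v, F i (F j v) = F j (F i v))
           (nilF : forall i, exists n, forall v, iter n (F i) v = 0).

(** Induction on the dimension of a nonzero stable subspace: if some [F i] is nonzero on it, the
    kernel of [F i] there is smaller, nonzero by nilpotency and stable by commutation. *)
Lemma common_kernel : {:M}%VS != 0%VS ->
  exists2 v : M, v != 0 & forall i, F i v = 0.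
Proof.
suff main d (U : {vspace M}) : (\dim U <= d)%N -> U != 0%VS ->
    (forall i v, v \in U -> F i v \in U) ->
    exists2 v, v != 0 & forall i, F i v = 0.
  by move=> M0; apply: (main _ _ (leqnn _) M0) => *; apply: memvf.
elim: d U => [|d IHd] U; first by rewrite leqn0 dimv_eq0 => ->.
move=> le_d U0 FU; have w0 : vpick U != 0 by rewrite vpick0.
have [[i [u [uU Fu0]]]|noF] := pselect (exists i u, u \in U /\ F i u != 0);
  last first.
  exists (vpick U) => // i; apply/eqP; apply: contrapT => Fi0; apply: noF.
  by exists i, (vpick U); split; [apply: memv_pick | apply/negP].
have [||U' U'P] := @vspace_of_pred _ _ (fun v => v \in U /\ F i v = 0).
- by rewrite mem0v (plin0 (lin_F i)).
- move=> a v v' [vU Fv] [v'U Fv']; rewrite memvD ?memvZ //.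
  by rewrite (lin_F i a) Fv Fv' scaler0 addr0.
have exn : exists n, iter n (F i) (vpick U) == 0.
  by have [n nP] := nilF i; exists n; rewrite nP.
apply: (IHd U') => [||j v /U'P[vU Fv]].
- rewrite -ltnS (leq_trans _ le_d) // ltn_neqAle; apply/andP; split; last first.
    by apply/dimvS/subvP=> v /U'P[].
  apply: contra Fu0 => /eqP eqd; suff /U'P[_ ->] : u \in U' by [].
  suff -> : U' = U by []; apply/eqP; rewrite eqEdim eqd leqnn andbT.
  by apply/subvP=> v /U'P[].
- case: (ex_minnP exn) => -[|n] Fn nmin; first by rewrite (negPf w0) in Fn.
  have FnU : iter n (F i) (vpick U) \in U'.
    apply/U'P; split; last exact/eqP.
    by elim: (n) => [|k IHk]; [apply: memv_pick | apply: FU].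
  apply: contraTneq FnU => ->; rewrite memv0; apply/negP => /nmin.
  by rewrite ltnn.
by apply/U'P; rewrite FU // commF Fv (plin0 (lin_F j)).
Qed.

End CommonKernel.

Section Support.
Variables (K : fieldType) (g : finLieAlgType K).

Definition supported_on (s : seq K) (M : lieModule (current g)) : Prop :=
  forall x f, all (root f) s -> forall v : M, act (x *t f : current g) v = 0.

Lemma current_ind (P : current g -> Prop) :
    P 0 -> (forall u u', P u -> P u' -> P (u + u')) ->
    (forall x f, P (x *t f)) ->
  forall u, P u.
Proof. exact: tens_ind. Qed.

Lemma act_lie_pure (M : lieModule (current g)) x y f h (v : M) :
  act (lie x y *t (f * h) : current g) v =
  act (x *t f : current g) (act (y *t h : current g) v) -
  act (y *t h : current g) (act (x *t f : current g) v).
Proof. by rewrite -lie_pure act_lie. Qed.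

Lemma act_pure_linearl (M : lieModule (current g)) f (v : M) :
  linear (fun x => act (x *t f : current g) v).
Proof. by move=> a x y; rewrite (@pure_linearl _ _ _ f a) (act_linearl v a).
  Qed.

Lemma act_pure_linearr (M : lieModule (current g)) x (v : M) :
  linear (fun f => act (x *t f : current g) v).
Proof. by move=> a f h; rewrite (@pure_linearr _ _ _ x a) (act_linearl v a).
  Qed.

(** Polynomials form an infinite-dimensional space, while their actions through a basis of g live in
    a finite-dimensional one, so some p <> 0 has g (x) p acting by 0. Then [y, z] (x) p h =
    [y (x) p, z (x) h] acts by 0 too, and g is perfect. *)
Lemma annihilating_poly (M : lieModule (current g)) : simple_lie g ->
  exists2 p : {poly K}, p != 0 &
    forall x h (v : M), act (x *t (p * h) : current g) v = 0.
Proof.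
move=> g_simple; pose b := vbasis {:g}.
pose A (x : g) (f : {poly K}) : 'Hom(M, M) := linfun (act (x *t f : current g)).
have AE x f v : A x f v = act (x *t f : current g) v.
  exact/lfun_linearE/act_linearr.
pose T : vectType K := {ffun 'I_(\dim {:g}) -> 'Hom(M, M)}.
pose Phi (f : {poly K}) : T := [ffun i : 'I_(\dim {:g}) => A b`_i f].
have linPhi : linear Phi.
  move=> a f h; apply/ffunP=> i; rewrite !ffunE; apply/lfunP=> v.
  by rewrite add_lfunE scale_lfunE !AE (act_pure_linearr _ _ a).
(* One monomial more than dim T forces a linear relation among the images; its coefficients are
   those of p. *)
pose n := (\dim {:T}).+1; pose X := [tuple Phi 'X^i | i < n].
have : ~~ free X.
  rewrite /free eqn_leq negb_and orbC -ltnNge size_tuple /n ltnS.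
  by rewrite dimvS // subvf.
move=> /freeP; rewrite -existsNE => -[k].
move/not_implyP => [kX /existsNP[i ki]].
pose p := \sum_(j < n) k j *: 'X^j.
have pE (j : 'I_n) : p`_j = k j.
  rewrite /p coef_sum (bigD1 j) //= big1 => [|j' jj']; rewrite !coefZ coefXn.
    by rewrite eqxx mulr1 addr0.
  by rewrite eq_sym (negPf (_ : val j' != val j)) ?mulr0.
have p0 : Phi p = 0.
  rewrite /p (plin_sum linPhi) -[RHS]kX; apply: eq_bigr => j _.
  by rewrite (plinZ linPhi) (nth_map j) ?size_enum_ord // nth_ord_enum.
exists p; first by apply/eqP => p00; apply: ki; rewrite -pE p00 coef0.
have p1 x (v : M) : act (x *t p : current g) v = 0.
  have bj j : act (b`_(j : 'I_(\dim {:g})) *t p : current g) v = 0.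
    rewrite -[LHS](AE b`_j p v); have /ffunP/(_ j) := p0;
      rewrite !ffunE => ->; exact: zero_lfunE.
  rewrite (coord_vbasis (memvf x)) (plin_sum (act_pure_linearl p v)).
  by rewrite big1 // => j _; rewrite (plinZ (act_pure_linearl p v)) bj scaler0.
move=> x h v; apply: (@lie_perfect_ind _ _ (fun x =>
  act (x *t (p * h) : current g) v = 0)) => //.
- exact: (plin0 (act_pure_linearl _ v)).
- by move=> a y z y0 z0; rewrite (act_pure_linearl _ v a) y0 z0 scaler0 addr0.
by move=> y z; rewrite act_lie_pure !p1 (plin0 (act_linearr _)) subrr.
Qed.

End Support.

Section IrreducibleSupport.
Variables (C : numClosedFieldType) (g : finLieAlgType C).
Hypothesis g_simple : simple_lie g.

Lemma end_mx_lie (L : lieAlgType C) (M : lieModule L) (x y : L) :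
  end_mx (act (l := M) (lie x y)) =
  mx_ad (end_mx (act (l := M) x)) (end_mx (act (l := M) y)).
Proof.
rewrite /mx_ad -!end_mxM; try exact: act_linearr.
rewrite addrC -scaleN1r -end_mxP; apply: end_mx_ext => v.
by rewrite act_lie scaleN1r addrC.
Qed.

(* The elements of the abelian ideal [g (x) (f ^+ k.+1)] of the image of      *)
(* [g[t]] in [End M] are sums of commutators commuting with it, hence         *)
(* nilpotent; their common kernel is a nonzero submodule.                     *)
Lemma irreducible_descent (M : lieModule (current g)) (f : {poly C}) k :
    irreducible M ->
    (forall x h (v : M), act (x *t (f ^+ k.+2 * h) : current g) v = 0) ->
  forall x h (v : M), act (x *t (f ^+ k.+1 * h) : current g) v = 0.
Proof.
move=> [M0 Mirr] kill.
pose F (u : g * {poly C}) (v : M) := act (u.1 *t (f ^+ k.+1 * u.2) : current g)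
  v.
have linF u : linear (F u) by apply: act_linearr.
have commF u u' v : F u (F u' v) = F u' (F u v).
  apply/eqP; rewrite -subr_eq0 -act_lie_pure.
  have -> : f ^+ k.+1 * u.2 * (f ^+ k.+1 * u'.2) = f ^+ k.+2 * (f ^+ k * u.2 *
    u'.2).
    by rewrite !exprS; ring.
  by rewrite kill.
have nilF u : exists n, forall v, iter n (F u) v = 0.
  exists (\dim {:M}) => v.
  suff nil : end_mx (iter (\dim {:M}) (F u)) = end_mx (fun=> 0).
    by apply: (end_mx_inj (iter_linear _ _) _ nil) => // a w w';
      rewrite scaler0 addr0.
  have -> : end_mx (fun=> 0 : M) = 0 by apply/matrixP=> i j;
    rewrite !mxE linear0.
  rewrite end_mx_iter //; apply: nilpotent_comm => A comA.
  pose Q y := \tr (A *m end_mx (F (y, u.2))) = 0.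
  apply: (@lie_perfect_ind _ _ Q) => // [|a y z|y z]; rewrite /Q.
  - rewrite (_ : end_mx _ = 0) ?mulmx0 ?mxtrace0 //; apply/matrixP=> i j.
    by rewrite !mxE /F (plin0 (act_pure_linearl _ _)) linear0.
  - move=> Qy Qz; rewrite (_ : end_mx _ = a *: end_mx (F (y, u.2)) + end_mx (F
      (z, u.2))).
      by rewrite mulmxDr -scalemxAr mxtraceD mxtraceZ Qy Qz mulr0 addr0.
    by rewrite -end_mxP; apply: end_mx_ext => w;
      rewrite /F (act_pure_linearl _ _ a).
  have -> : end_mx (F (lie y z, u.2)) =
      mx_ad (end_mx (F (y, u.2))) (end_mx (act (l := M) (z *t 1 : current g))).
    rewrite -end_mx_lie; apply: end_mx_ext => w.
    by rewrite lie_pure mulr1.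
  (* [F (y, u.2)] commutes with [F u], hence with [A], so the commutator in the trace vanishes. *)
  rewrite mxtrace_ad /mx_ad (comA (end_mx (F (y, u.2)))) ?subrr ?mul0mx
    ?mxtrace0 //.
  rewrite /comm_mx -!end_mxM //; apply: end_mx_ext => w; exact: commF.
have [w w0 wF] := common_kernel linF commF nilF M0.
have [||U UP] := @vspace_of_pred _ M (fun v => forall u, F u v = 0).
- by move=> u; apply: plin0.
- by move=> a v v' v0 v'0 u; rewrite (linF u a) v0 v'0 scaler0 addr0.
have subU : submodule U.
  elim/current_ind => [v _|z z' IHz IHz' v vU|y h v /UP v0].
  - by rewrite (plin0 (act_linearl v)) mem0v.
  - by rewrite (plinD (act_linearl v)) memvD ?IHz ?IHz'.
  apply/UP => -[x h']; rewrite /F /=; apply/eqP.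
  have := act_lie_pure x y (f ^+ k.+1 * h') h v.
  rewrite -mulrA [LHS](v0 (lie x y, h' * h)).
  have -> : act (x *t (f ^+ k.+1 * h') : current g) v = 0 := v0 (x, h').
  by rewrite (plin0 (act_linearr _)) subr0 => <-.
have [U0|Uf] := Mirr U subU.
  by have /UP : (forall u, F u w = 0) := wF; rewrite U0 memv0 (negPf w0).
by move=> x h v; have /UP/(_ (x, h)) : v \in U by rewrite Uf memvf.
Qed.

(** With r the product over the distinct roots of an annihilating p, some power of r is a multiple
    of p and so kills M; the descent brings the exponent down to 1. A polynomial vanishing on the
    roots is a multiple of r. *)
Lemma irreducible_supported (M : lieModule (current g)) : irreducible M ->
  exists2 s, uniq s & supported_on s M.
Proof.
move=> Mirr; have [p p0 pM] := annihilating_poly M g_simple.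
have [rs pE] := closed_field_poly_normal p.
pose s := undup rs; exists s; first exact: undup_uniq.
pose r : {poly C} := \prod_(a <- s) ('X - a%:P).
have kill : exists k, forall x h (v : M), act (x *t (r ^+ k.+1 * h) : current
  g) v = 0.
  exists (size rs) => x h v.
  have /dvdpP[w wE] : p %| r ^+ (size rs).+1.
    rewrite pE dvdpZl ?lead_coef_eq0 // exprS dvdp_mull // prod_XsubC_dvdp_exp
      //.
    by move=> a ars; rewrite /r (big_rem a) ?mem_undup //= dvdp_mulr.
  by rewrite wE mulrC [w * p]mulrC mulrCA.
have {kill} [k] := kill; elim: k => [kill|k IHk kill]; last first.
  exact/IHk/irreducible_descent.
move=> x f fs v; have : r %| f by rewrite uniq_roots_dvdp // uniq_rootsE
  undup_uniq.
by case/dvdpP=> h ->; rewrite mulrC -[r]expr1.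
Qed.

End IrreducibleSupport.

(** * The Casimir operator and Whitehead's lemma *)

Definition is_cocycle1 (K : fieldType) (L : lieAlgType K) (M : lieModule L)
    (c : L -> M) : Prop :=
  linear c /\ forall x y, c (lie x y) = act x (c y) - act y (c x).

Section Casimir.
Variables (C : numClosedFieldType) (g : finLieAlgType C).
Hypothesis g_simple : simple_lie g.

Section InvariantForm.
Variable beta : g -> g -> C.
Hypotheses (beta_linl : forall y, linear (fun x => beta x y : C^o))
           (betaC : forall x y, beta x y = beta y x)
           (beta_inv : forall x y z, beta (lie z x) y = - beta x (lie z y))
           (beta_nz : exists x y, beta x y <> 0).
Local Notation b := (vbasis {:g}).
Local Notation n := (\dim {:g}).

Let gram : 'M[C]_n := \matrix_(k, l) beta b`_k b`_l.

Let beta_linr x : linear (fun y => beta x y : C^o).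
Proof. by move=> a y z; rewrite betaC (beta_linl x a) !(betaC x). Qed.

Let gram_unit : gram \in unitmx.
Proof.
rewrite -row_free_unit; apply: inj_row_free => u ug0.
have [||//|rad0|rad] := @simple_ideal _ g (fun x =>
  forall y, beta x y = 0) g_simple.
- by move=> y; apply: (plin0 (beta_linl y)).
- by move=> a x y x0 y0 z; rewrite (beta_linl z a) x0 y0 scaler0 addr0.
- by move=> x y y0 z; rewrite beta_inv y0 oppr0.
- pose x := \sum_k u 0 k *: b`_k.
  have x0 : x = 0.
    apply: rad0 => y; rewrite (coord_vbasis (memvf y)) (plin_sum (beta_linr x)).
    rewrite big1 // => l _; rewrite (plinZ (beta_linr x)).
    suff -> : beta x b`_l = 0 by rewrite scaler0.
    have /rowP/(_ l) := ug0; rewrite !mxE => <-.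
    rewrite /x (plin_sum (beta_linl _)); apply: eq_bigr => k _.
    by rewrite (plinZ (beta_linl _)) !mxE.
  apply/rowP=> k; rewrite !mxE.
  have /freeP fb := basis_free (vbasisP {:g}).
  exact: (fb (fun k => u 0 k)).
by have [x [y]] := beta_nz; rewrite rad.
Qed.

(** With D the inverse Gram matrix, the sum of the D_kl b_k (x) b_l is the invariant Casimir tensor
    of [beta]. Invariance is stated through bilinear maps [F] because it is applied both to the
    module action and to a cocycle. *)
Lemma casimir_tensor : exists D : 'M[C]_n,
  (forall (T : lmodType C) (F : g -> g -> T) z,
     (forall y, linear (F^~ y)) -> (forall x, linear (F x)) ->
     \sum_k \sum_l D k l *: (F (lie z b`_k) b`_l + F b`_k (lie z b`_l)) = 0) /\
  \sum_k \sum_l D k l * beta b`_k b`_l = n%:R.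
Proof.
pose D := invmx gram; exists D; split=> [T F z linl linr|]; last first.
  have gramC : gram^T = gram by apply/matrixP=> k l; rewrite !mxE betaC.
  have : \tr (D *m gram^T) = n%:R by rewrite gramC mulVmx ?gram_unit //
    mxtrace1.
  move=> <-; apply: eq_bigr => k _; rewrite mxE; apply: eq_bigr => l _.
  by rewrite !mxE.
pose A : 'M[C]_n := \matrix_(m, k) coord b m (lie z b`_k).
have AE (k : 'I_n) : lie z b`_k = \sum_m A m k *: b`_m.
  rewrite {1}(coord_vbasis (memvf (lie z b`_k))).
  by apply: eq_bigr => m _; rewrite mxE.
(* Invariance of [beta] in coordinates; multiplying by D on both sides transfers it to D. *)
have gA : gram *m A + A^T *m gram = 0.
  apply/matrixP=> k l; rewrite !mxE.
  have -> : \sum_j gram k j * A j l = beta b`_k (lie z b`_l).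
    rewrite AE (plin_sum (beta_linr _)); apply: eq_bigr => m _.
    by rewrite (plinZ (beta_linr _)) mxE mulrC.
  have -> : \sum_j A^T k j * gram j l = beta (lie z b`_k) b`_l.
    rewrite AE (plin_sum (beta_linl _)); apply: eq_bigr => m _.
    by rewrite (plinZ (beta_linl _)) !mxE.
  by rewrite beta_inv subrr.
have AD : A *m D + D *m A^T = 0.
  have : D *m (gram *m A + A^T *m gram) *m D = 0 by rewrite gA mulmx0 mul0mx.
  rewrite mulmxDr mulmxDl !mulmxA mulVmx ?gram_unit // mul1mx.
  by rewrite -!mulmxA mulmxV ?gram_unit // mulmx1.
have -> : \sum_k \sum_l D k l *: (F (lie z b`_k) b`_l + F b`_k (lie z b`_l)) =
    \sum_k \sum_l (A *m D + D *m A^T) k l *: F b`_k b`_l.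
  under eq_bigr do under eq_bigr do rewrite scalerDr.
  under eq_bigr do rewrite big_split.
  under [RHS]eq_bigr do under eq_bigr do rewrite mxE scalerDl.
  under [RHS]eq_bigr do rewrite big_split.
  rewrite !big_split; congr (_ + _).
    rewrite exchange_big [RHS]exchange_big; apply: eq_bigr => l _ /=.
    under eq_bigr => k _.
      rewrite AE (plin_sum (linl _)) scaler_sumr.
      under eq_bigr => m _ do rewrite (plinZ (linl _)) scalerA mulrC.
      over.
    rewrite exchange_big; apply: eq_bigr => m _ /=.
    by rewrite mxE scaler_suml.
  apply: eq_bigr => k _ /=.
  under eq_bigr => l _.
    rewrite AE (plin_sum (linr _)) scaler_sumr.
    under eq_bigr => m _ do rewrite (plinZ (linr _)) scalerA.
    over.
  rewrite exchange_big; apply: eq_bigr => m _ /=.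
  by rewrite mxE scaler_suml; apply: eq_bigr => l _; rewrite [A^T _ _]mxE.
by rewrite AD; apply: big1 => k _; apply: big1 => l _; rewrite mxE scale0r.
Qed.

End InvariantForm.

Variables (L : lieAlgType C) (M : lieModule L) (j : g -> L) (e : L -> g) (c : L
  -> M).
Hypotheses (Mirr : irreducible M) (lin_j : linear j) (jK : cancel j e)
  (act_j : forall z x (v : M), act (lie z (j x)) v = act (j (lie (e z) x)) v)
  (coc : is_cocycle1 c)
  (c_j : forall z x, c (lie z (j x)) = c (j (lie (e z) x)))
  (j_nz : exists x (v : M), act (j x) v <> 0).

(** For the action and for [c], [j] makes g behave as an ideal of L on which L acts through [e]. The
    Casimir operator [Om] of the trace form of M then commutes with all of L, and its kernel is a
    submodule; since tr Om = dim g is nonzero, irreducibility makes [Om] invertible. *)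
Lemma casimir_coboundary : exists m, forall z, c z = act z m.
Proof.
have [lin_c c_lie] := coc; have [M0 Msub] := Mirr.
pose r x : 'M[C]_(\dim {:M}) := end_mx (act (l := M) (j x)).
have act_jlin (v : M) : linear (fun x => act (j x) v).
  by move=> a x y; rewrite (lin_j a) (act_linearl v a).
have r_lin : linear r.
  by move=> a x y; rewrite /r -end_mxP; apply: end_mx_ext => v;
    rewrite (act_jlin v a).
have r_lie x y : r (lie x y) = mx_ad (r x) (r y).
  rewrite /r -end_mx_lie; apply: end_mx_ext => v.
  by rewrite act_j jK.
have tr0 : \tr (0 : 'M[C]_(\dim {:M})) = 0 by rewrite mxtrace0.
have [||||D [Dinv Dtr]] := @casimir_tensor (fun x y => \tr (r x *m r y)).
- by move=> y a x x'; rewrite (r_lin a) mulmxDl -scalemxAl mxtraceD mxtraceZ.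
- by move=> x y; rewrite mxtrace_mulC.
- move=> x y z; rewrite !r_lie; apply/eqP; rewrite -subr_eq0 opprK; apply/eqP.
  rewrite mxtrace_ad -mxtraceD -mulmxDl.
  have -> : mx_ad (r z) (r x) + mx_ad (r x) (r z) = 0.
    by rewrite /mx_ad addrA subrK subrr.
  by rewrite mul0mx.
- apply: contrapT => beta0; have [x [v]] := j_nz; apply.
  have rx0 : r x = 0.
    apply: (cartan_trace g_simple r_lin r_lie) => y z.
    by apply: contrapT => yz; apply: beta0; exists y, z.
  have lin0 : linear (fun _ : M => 0 : M) by move=> a u w;
    rewrite scaler0 addr0.
  have e0 : end_mx (act (l := M) (j x)) = end_mx (fun=> 0 : M).
    by rewrite -/(r x) rx0; apply/matrixP=> i k; rewrite !mxE linear0.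
  exact: (end_mx_inj (act_linearr (j x)) lin0 e0 v).
pose b := vbasis {:g}.
pose Om (v : M) := \sum_k \sum_l D k l *: act (j b`_k) (act (j b`_l) v).
have OmL : linear Om.
  move=> a u v; rewrite /Om scaler_sumr -big_split; apply: eq_bigr => k _ /=.
  rewrite scaler_sumr -big_split; apply: eq_bigr => l _ /=.
  by rewrite (act_linearr _ a) (act_linearr _ a) scalerDr !scalerA mulrC.
(* Used for both w(y) = j(y) v and w(y) = c(j(y)): the terms in ad (e z) cancel by invariance of the
   Casimir tensor. *)
have comm z (w : g -> M) (wz : g -> M) :
    linear w -> linear wz ->
    (forall y, act z (w y) = w (lie (e z) y) + wz y) ->
  act z (\sum_k \sum_l D k l *: act (j b`_k) (w b`_l)) =
  \sum_k \sum_l D k l *: act (j b`_k) (wz b`_l).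
  move=> lin_w lin_wz wE; apply/eqP; rewrite -subr_eq0; apply/eqP.
  rewrite -[RHS](Dinv M (fun x y => act (j x) (w y)) (e z)); last first.
  - by move=> x a y y'; rewrite (lin_w a) (act_linearr _ a).
  - by move=> y; apply: act_jlin.
  rewrite (plin_sum (act_linearr z)) -sumrB; apply: eq_bigr => k _.
  rewrite (plin_sum (act_linearr z)) -sumrB; apply: eq_bigr => l _.
  rewrite (plinZ (act_linearr z)) -scalerBr; congr (_ *: _).
  have := act_lie z (j b`_k) (w b`_l); rewrite act_j => /esym/eqP.
  rewrite subr_eq => /eqP ->.
  by rewrite wE (plinD (act_linearr _)) addrA addrK.
have Omact z v : act z (Om v) = Om (act z v).
  apply: (comm z (fun y => act (j y) v) (fun y => act (j y) (act z v))).
  - exact: act_jlin.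
  - exact: act_jlin.
  - by move=> y; rewrite -act_j act_lie subrK.
(* If c(z) = z m, this vector equals [Om m]; accordingly m is found as the preimage of [w] under
   [Om]. *)
pose w := \sum_k \sum_l D k l *: act (j b`_k) (c (j b`_l)).
have cj_lin : linear (fun y => c (j y)).
  by move=> a x y; rewrite (lin_j a) (lin_c a).
have wE z : act z w = Om (c z).
  apply: (comm z (fun y => c (j y)) (fun y => act (j y) (c z))) => //.
  by move=> y; rewrite -c_j c_lie subrK.
have [||U UP] := @vspace_of_pred _ M (fun v => Om v = 0).
- exact: plin0.
- by move=> a u v u0 v0; rewrite (OmL a) u0 v0 scaler0 addr0.
have [|U0|Uf] := Msub U.
- by move=> z v; rewrite !UP -Omact => ->; rewrite (plin0 (act_linearr z)).
- have Om_inj v : Om v = 0 -> v = 0.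
    by move/UP; rewrite U0 memv0 => /eqP.
  have Om_lker : lker (linfun Om) == 0%VS.
    apply/eqP/vspaceP=> v; rewrite memv_ker memv0 (lfun_linearE OmL).
    by apply/eqP/eqP=> [/Om_inj //|->]; rewrite (plin0 OmL).
  pose m := (linfun Om)^-1%VF w.
  have Omm : Om m = w.
    by rewrite -(lfun_linearE OmL) lker0_lfunVK.
  exists m => z; apply/eqP; rewrite -subr_eq0; apply/eqP/Om_inj.
  by rewrite (plinB OmL) -Omact Omm wE subrr.
(* Remaining case: [Om] is zero, against tr Om = dim g in characteristic 0. *)
have : (\dim {:g})%:R = 0 :> C.
  rewrite -Dtr -[RHS]tr0.
  have -> : 0 = end_mx Om.
    apply/matrixP=> p q; rewrite !mxE (_ : Om _ = 0) ?linear0 //.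
    by apply/UP; rewrite Uf memvf.
  have -> : end_mx Om = \sum_k \sum_l D k l *: (r b`_k *m r b`_l).
    apply/matrixP=> p q; rewrite mxE summxE linear_sum; apply: eq_bigr => k _.
    rewrite summxE linear_sum; apply: eq_bigr => l _ /=.
    by rewrite linearZ /= -end_mxM ?mxE //; apply: act_linearr.
  rewrite linear_sum; apply: eq_bigr => k _; rewrite linear_sum;
    apply: eq_bigr => l _ /=.
  by rewrite mxtraceZ.
move/eqP; rewrite pnatr_eq0 dimv_eq0 => /eqP g0.
have [[x [y]]] := g_simple.
by have := memvf (lie x y); rewrite g0 memv0 => ->.
Qed.

End Casimir.

Lemma delta_polys (K : fieldType) (s : seq K) : uniq s ->
  exists e : K -> {poly K}, forall a b, a \in s -> (e b).[a] = (a == b)%:R.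
Proof.
move=> us; exists (fun b => sval (cid (poly_interp 1 (fun a =>
  (a == b)%:R) us))).
move=> a b as_; case: cid => q /= /(_ a as_) /dvdpP[w].
by move/eqP; rewrite subr_eq => /eqP ->; rewrite !hornerE subrr mulr0 add0r.
Qed.

Section Whitehead.
Variables (C : numClosedFieldType) (g : finLieAlgType C).

Section SupportedMap.
Variables (s : seq C) (T : lmodType C) (phi : current g -> T).
Hypotheses (lin_phi : linear phi)
           (supp_phi : forall x f, all (root f) s -> phi (x *t f) = 0).

Lemma supported_eq x (f h : {poly C}) : {in s, forall a, f.[a] = h.[a]} ->
  phi (x *t f) = phi (x *t h).
Proof.
move=> fh; apply/eqP; rewrite -subr_eq0 -(plinB lin_phi).
rewrite -(plinB (@pure_linearr _ g {poly C} x)) supp_phi //.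
by apply/allP => a as_; rewrite /root !hornerE fh // subrr.
Qed.

(** Modulo polynomials vanishing on [s], f e = f(a) e; so g (x) e behaves as an ideal on which g[t]
    acts through evaluation at a. *)
Lemma supported_ideal (e : {poly C}) a z x :
    {in s, forall b, e.[b] = (b == a)%:R} ->
  phi (lie z (x *t e : current g)) = phi (lie (eval_at a z) x *t e).
Proof.
move=> eP; elim/current_ind: z => [|u u' IHu IHu'|y f].
- rewrite (plin0 (lie_linearl _)) (plin0 (eval_at_linear a)) (plin0
    (lie_linearl _)).
  by rewrite (plin0 (@pure_linearl _ g {poly C} e)).
- rewrite (plinD (lie_linearl _)) (plinD (eval_at_linear a)) (plinD
    (lie_linearl _)).
  by rewrite (plinD (@pure_linearl _ g {poly C} e)) !(plinD lin_phi) IHu IHu'.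
rewrite lie_pure eval_at_pure (plinZ (lie_linearl _)).
rewrite (plinZ (@pure_linearl _ g {poly C} e)) -(plinZ (@pure_linearr _ g {poly
  C} _)).
apply: supported_eq => b bs; rewrite !hornerE eP //.
by case: eqP => [->|_]; rewrite ?mulr0.
Qed.

End SupportedMap.

Lemma supported_act0 s (e : C -> {poly C}) (M : lieModule (current g)) (v : M) :
    uniq s -> (forall a b, a \in s -> (e b).[a] = (a == b)%:R) ->
    supported_on s M ->
    (forall a, a \in s -> forall x, act (x *t e a : current g) v = 0) ->
  forall z, act z v = 0.
Proof.
move=> us eP suppM act_e; elim/current_ind => [|u u' IHu IHu'|x f].
- exact: (plin0 (act_linearl v)).
- by rewrite (plinD (act_linearl v)) IHu IHu' addr0.
have -> : act (x *t f : current g) v =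
          act (x *t (\sum_(a <- s) f.[a] *: e a) : current g) v.
  apply: (supported_eq (act_linearl v) (fun x f fs => suppM x f fs v)) => b bs.
  rewrite horner_sum (bigD1_seq b) //= hornerZ eP // eqxx mulr1.
  rewrite big1_seq ?addr0 // => a /andP[ab _].
  by rewrite hornerZ eP // eq_sym (negPf ab) mulr0.
rewrite (plin_sum (act_pure_linearr x v)) big1_seq // => a as_.
by rewrite (plinZ (act_pure_linearr x v)) act_e // scaler0.
Qed.

Hypothesis g_simple : simple_lie g.

Lemma coboundary_cocycle (L : lieAlgType C) (M : lieModule L) (m : M) :
  is_cocycle1 (fun z => act z m).
Proof. by split=> [|x y]; [apply: act_linearl | apply: act_lie]. Qed.

(** Modulo polynomials vanishing on [s], g[t] is a sum of copies g (x) e_a of g. If one of them acts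
    nontrivially, its Casimir operator settles the matter; otherwise the action is zero, and c kills
    brackets, hence everything. *)
Lemma whitehead_irreducible s (M : lieModule (current g)) (c : current g -> M) :
    uniq s -> irreducible M -> supported_on s M -> is_cocycle1 c ->
    (forall x f, all (root f) s -> c (x *t f) = 0) ->
  exists m, forall z, c z = act z m.
Proof.
move=> us Mirr suppM coc suppc; have [e eP] := delta_polys us.
have [lin_c c_lie] := coc.
have lin_p f : linear (fun x : g => x *t f : current g) := @pure_linearl _ g _
  f.
have [[a [as_ j_nz]]|noj] :=
  pselect (exists a, a \in s /\ exists x (v : M), act (x *t e a : current g) v
    <> 0).
  have ea : {in s, forall b, (e a).[b] = (b == a)%:R} by move=> b bs; apply: eP.
  apply: (casimir_coboundary g_simple Mirr (lin_p (e a)) (e := eval_at a) _ _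
    coc _ j_nz).
  - by move=> x; rewrite eval_at_pure eP // eqxx scale1r.
  - move=> z x v.
    exact: (supported_ideal (act_linearl v) (fun x f fs =>
      suppM x f fs v) z x ea).
  - by move=> z x; apply: (supported_ideal lin_c suppc).
have act0 z (v : M) : act z v = 0.
  apply: (supported_act0 us eP suppM) => a as_ x; apply: contrapT => nz.
  by apply: noj; exists a; split=> //; exists x, v.
exists 0 => z; rewrite act0; elim/current_ind: z => [|u u' IHu IHu'|x f].
- exact: (plin0 lin_c).
- by rewrite (plinD lin_c) IHu IHu' addr0.
apply: (@lie_perfect_ind _ _ (fun x => c (x *t f) = 0)) =>
  // [|a y z y0 z0|y z].
- by rewrite (plin0 (lin_p f)) (plin0 lin_c).
- by rewrite (lin_p f a) (lin_c a) y0 z0 scaler0 addr0.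
by rewrite -[f]mul1r -lie_pure c_lie !act0 subrr.
Qed.

(** Induction on dim M along a proper nonzero submodule U: after subtraction of the coboundary of a
    lift of the solution in M / U, the cocycle takes its values in U. *)
Lemma whitehead s (M : lieModule (current g)) (c : current g -> M) :
    uniq s -> supported_on s M -> is_cocycle1 c ->
    (forall x f, all (root f) s -> c (x *t f) = 0) ->
  exists m, forall z, c z = act z m.
Proof.
move=> us; have [d] : {d | (\dim {:M} <= d)%N} by exists (\dim {:M}).
elim: d M c => [|d IHd] M c le_d suppM coc suppc.
  exists 0 => z; move: le_d; rewrite leqn0 dimv_eq0 => /eqP M0.
  rewrite (plin0 (act_linearr z)); apply/eqP.
  by have := memvf (c z); rewrite M0 memv0.
have [Mirr|Mred] := pselect (irreducible M);
  first exact: whitehead_irreducible suppc.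
have [M0|M_nz] := eqVneq {:M}%VS 0%VS.
  exists 0 => z; rewrite (plin0 (act_linearr z)); apply/eqP.
  by have := memvf (c z); rewrite M0 memv0.
have [U [subU [U0 Uf]]] : exists U : {vspace M}, submodule U /\ U <> 0%VS /\ U
  <> fullv.
  apply: contrapT => noU; apply: Mred; split=> // U subU.
  apply: contrapT => /not_orP[U0 Uf]; apply: noU; by exists U.
have [lin_c c_lie] := coc.
have dU : (0 < \dim U < \dim {:M})%N.
  rewrite lt0n dimv_eq0 (introN eqP U0) ltn_neqAle dimvS ?subvf // andbT.
  by apply/eqP => eqd; apply: Uf; apply/eqP; rewrite eqEdim subvf eqd leqnn.
pose Q := quo_mod subU; pose S := sub_mod subU.
have lt_d k : (k < \dim {:M})%N -> (k <= d)%N by move=> lt_k;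
  rewrite -ltnS (leq_trans lt_k).
have dQ : (\dim {:Q} <= d)%N.
  have -> : \dim {:Q} = \dim (U^C)%VS by rewrite dimvf.
  rewrite dimv_compl lt_d // ltn_subrL; case/andP: dU => -> /=;
    exact: leq_trans.
have dS : (\dim {:S} <= d)%N.
  have -> : \dim {:S} = \dim U by rewrite dimvf.
  by rewrite lt_d //; case/andP: dU.
have qact z v : quo_proj U (act z v) = act (l := Q) z (quo_proj U v).
  by rewrite [RHS](quo_actE subU).
have [||x f fs|mQ mQP] := IHd Q (fun z => quo_proj U (c z)) dQ.
- move=> x f fs q; rewrite -[q](quo_reprK (U := U)) -qact suppM //.
  by rewrite linear0.
- split=> [a x y|x y]; first by rewrite (lin_c a) linearP.
  by rewrite c_lie linearB /= !qact.
- by rewrite suppc // linear0.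
pose m1 : M := quo_repr U mQ; pose c1 z := c z - act z m1.
have c1U z : c1 z \in U.
  rewrite -quo_proj_eq0 linearB /= qact mQP /m1 quo_reprK subrr.
  exact: eqxx.
have [lin_m1 m1_lie] := coboundary_cocycle m1.
have lin_c1 : linear c1.
  by move=> a x y; rewrite /c1 (lin_c a) (lin_m1 a) scalerBr opprD addrACA.
have c1_lie x y : c1 (lie x y) = act x (c1 y) - act y (c1 x).
  rewrite /c1 c_lie m1_lie !(plinB (act_linearr _)) !opprB.
  by rewrite -!addrA; congr (_ + _); rewrite addrCA [RHS]addrCA;
    congr (_ + _); rewrite addrC.
have valc1 z : vsval (vsproj U (c1 z)) = c1 z by rewrite vsprojK.
have [||x f fs|m2 m2P] := IHd S (fun z => vsproj U (c1 z)) dS.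
- move=> x f fs v; apply: val_inj; rewrite /= (sub_actE subU) suppM //.
- split=> [a x y|x y]; first by rewrite (lin_c1 a) linearP.
  by rewrite c1_lie linearB /= /sub_act !valc1.
- by rewrite /c1 suppc // suppM // subrr linear0.
exists (m1 + vsval m2) => z.
have := congr1 vsval (m2P z); rewrite valc1 /= (sub_actE subU) /c1.
by rewrite (plinD (act_linearr z)) => <-; rewrite addrC subrK.
Qed.

End Whitehead.

(** * First cohomology of the current algebra *)

Section FirstCohomology.
Variables (C : numClosedFieldType) (g : finLieAlgType C).

(** The basic 1-cocycle with values in [eval_mod g a]; its images under morphisms to M yield all of
    H^1(g[t], M). *)
Definition eval_deriv (a : C) (u : current g) : g :=
  tens_lift (fun x f => (f^`()).[a] *: x) u.

Lemma eval_deriv_linear a : linear (eval_deriv a).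
Proof.
apply: tens_lift_linear => x b f h.
by rewrite derivD derivZ hornerD hornerZ scalerDl scalerA.
Qed.

Lemma eval_deriv_pure a x f : eval_deriv a (x *t f) = (f^`()).[a] *: x.
Proof.
apply: tens_liftE => [h b y z|y b h k].
  by rewrite scalerDr !scalerA mulrC.
by rewrite derivD derivZ hornerD hornerZ scalerDl scalerA.
Qed.

Lemma eval_deriv_lie a (u v : current g) : eval_deriv a (lie u v) =
  lie (eval_at a u) (eval_deriv a v) + lie (eval_deriv a u) (eval_at a v).
Proof.
pose E0 := plin0 (@eval_at_linear _ g a);
  pose ED := plinD (@eval_at_linear _ g a).
pose D0 := plin0 (eval_deriv_linear a); pose DD := plinD (eval_deriv_linear a).
elim/current_ind: u => [|u u' IHu IHu'|x f].
- by rewrite (plin0 (lie_linearl _)) E0 D0 !(plin0 (lie_linearl _)) addr0.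
- rewrite (plinD (lie_linearl _)) ED !DD !(plinD (lie_linearl _)) IHu IHu'.
  by rewrite addrACA.
elim/current_ind: v => [|v v' IHv IHv'|y h].
- by rewrite (plin0 (lie_linearr _)) E0 D0 !(plin0 (lie_linearr _)) addr0.
- rewrite (plinD (lie_linearr _)) ED !DD !(plinD (lie_linearr _)) IHv IHv'.
  by rewrite addrACA.
rewrite lie_pure !eval_at_pure !eval_deriv_pure derivM hornerD !hornerM.
rewrite !(plinZ (lie_linearl _)) !(plinZ (lie_linearr _)) !scalerA scalerDl.
by rewrite addrC.
Qed.

Lemma deriv_cocycle (M : lieModule (current g)) a
    (phi : 'Hom(eval_mod g a, M)) : phi \in homs (eval_mod g a) M ->
  is_cocycle1 (fun z => phi (eval_deriv a z)).
Proof.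
move/homsP => phiP; split=> [b x y|x y].
  by rewrite (eval_deriv_linear a b) linearP.
rewrite eval_deriv_lie (lieC (eval_deriv a x)) linearB /=.
by congr (_ - _); apply: phiP.
Qed.

Lemma double_root (K : fieldType) (f : {poly K}) b :
  f.[b] = 0 -> (f^`()).[b] = 0 -> ('X - b%:P) ^+ 2 %| f.
Proof.
move/eqP; rewrite -/(root f b) => /factor_theorem[w ->].
rewrite derivM derivXsubC mulr1 !hornerE subrr mulr0 add0r => /eqP.
by rewrite -/(root w b) => /factor_theorem[w' ->];
  rewrite -mulrA -expr2 dvdp_mull.
Qed.

(** Take (X - b) e_b with e_b congruent to the Kronecker delta to order 2 at each point of [s].
    These polynomials represent a basis of I / I^2. *)
Lemma hermite_polys (K : fieldType) (s : seq K) : uniq s ->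
  exists f : K -> {poly K}, forall a b, a \in s ->
    (f b).[a] = 0 /\ ((f b)^`()).[a] = (a == b)%:R.
Proof.
move=> us; pose e b := sval (cid (poly_interp 2 (fun a => (a == b)%:R) us)).
exists (fun b => ('X - b%:P) * e b) => a b as_.
have {e} -> : e b = sval (cid (poly_interp 2 (fun a => (a == b)%:R) us)) by [].
case: cid => q /= /(_ a as_) /dvdpP[w] /eqP; rewrite subr_eq => /eqP ->.
have : ('X - a%:P).[a] = 0 by rewrite !hornerE subrr.
move: ('X - a%:P) => l la; rewrite expr2 mulrA.
rewrite !(derivM, derivD, derivC, derivXsubC) !(hornerM, hornerD, hornerC) la.
rewrite !(mulr0, mul0r, mul1r, add0r, addr0) !derivE !hornerE subr0 mul1r.
by case: eqP => [->|_]; rewrite ?subrr ?mul0r ?mulr0 ?mulr1 ?hornerE ?addr0.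
Qed.

Variables (s : seq C) (M : lieModule (current g)).
Hypotheses (g_simple : simple_lie g) (us : uniq s) (suppM : supported_on s M).

(** The difference f - h is w p^2, where p vanishes on [s]; and c([y (x) w p, z (x) p]) = 0 since
    both factors act on M by zero. *)
Lemma cocycle_jet_eq (c : current g -> M) x (f h : {poly C}) : is_cocycle1 c ->
    {in s, forall a, f.[a] = h.[a] /\ (f^`()).[a] = (h^`()).[a]} ->
  c (x *t f) = c (x *t h).
Proof.
move=> [lin_c c_lie] fh; apply/eqP; rewrite -subr_eq0 -(plinB lin_c).
rewrite -(plinB (@pure_linearr _ g {poly C} x)).
pose p : {poly C} := \prod_(a <- s) ('X - a%:P).
have ps : all (root p) s.
  by apply/allP => a as_; rewrite /p root_prod_XsubC.
have /dvdpP[w ->] : p * p %| f - h.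
  rewrite -expr2 -prodrXl; apply: prod_XsubC_exp_dvdp => // a as_.
  have [fa fa'] := fh a as_.
  by apply: double_root; rewrite ?derivE !hornerE ?fa ?fa' subrr.
rewrite mulrA; apply/eqP.
apply: (@lie_perfect_ind _ _ (fun x => c (x *t (w * p * p)) = 0)) =>
  // [|a y z y0 z0|y z].
- by rewrite (plin0 (@pure_linearl _ g {poly C} _)) (plin0 lin_c).
- by rewrite (@pure_linearl _ g {poly C} _ a) (lin_c a) y0 z0 scaler0 addr0.
rewrite -lie_pure c_lie !suppM ?subrr //.
by apply/allP => a as_; rewrite rootM (allP ps) ?orbT.
Qed.

(** phi_a is the restriction of [c] to the a-part g (x) f_a of g (x) I / I^2. The cocycle built from
    the phi_a agrees with [c] on g (x) I, so Whitehead's lemma applies to the difference. *)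
Lemma cocycle_decomposition (c : current g -> M) : is_cocycle1 c ->
  exists2 phi : forall a, 'Hom(eval_mod g a, M),
    forall a, a \in s -> phi a \in homs (eval_mod g a) M &
    exists m, forall z, c z = \sum_(a <- s) phi a (eval_deriv a z) + act z m.
Proof.
move=> coc; have [lin_c c_lie] := coc; have [f fP] := hermite_polys us.
have lin_p h : linear (fun x : g => x *t h : current g) := @pure_linearl _ g _
  h.
have lin_r x : linear (fun h => x *t h : current g) := @pure_linearr _ g _ x.
have phi_lin a : linear (fun x : g => c (x *t f a)).
  by move=> b x y; rewrite (lin_p (f a) b) (lin_c b).
pose phi a : 'Hom(eval_mod g a, M) := linfun (fun x : g => c (x *t f a)).
have phiE a x : phi a x = c (x *t f a) by apply: lfun_linearE.
have fs a : all (root (f a)) s.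
  by apply/allP => b bs; rewrite /root (fP b a bs).1.
have phiP a : a \in s -> phi a \in homs (eval_mod g a) M.
  move=> as_; apply/homsP => z x; rewrite !phiE /=.
  have act_lin (v : M) := act_linearl v.
  elim/current_ind: z => [|u u' IHu IHu'|y h].
  - rewrite (plin0 (act_lin _)) /pull_act /= (plin0 (@eval_at_linear _ g a)).
    by rewrite (plin0 (lie_linearl _)) (plin0 (lin_p _)) (plin0 lin_c).
  - move: IHu IHu'; rewrite (plinD (act_lin _)) /pull_act /=.
    rewrite (plinD (@eval_at_linear _ g a)) (plinD (lie_linearl _)) (plinD
      (lin_p _)).
    by rewrite (plinD lin_c) => -> ->.
  (* x (x) f_a acts by zero, so the cocycle identity becomes equivariance; and h f_a has the same
     jets on [s] as h(a) f_a. *)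
  have /eqP := c_lie (y *t h) (x *t f a).
  rewrite (suppM _ (fs a)) subr0 eq_sym => /eqP ->.
  rewrite lie_pure /pull_act /= eval_at_pure (plinZ (lie_linearl _)).
  rewrite (plinZ (lin_p _)) -(plinZ (lin_r _)).
  apply: cocycle_jet_eq => // b bs; have [fb fb'] := fP b a bs.
  rewrite derivM derivZ !hornerE fb fb' !mulr0 add0r.
  by case: eqP => [->|_]; rewrite ?mulr0.
exists phi => //.
pose c' z := c z - \sum_(a <- s) phi a (eval_deriv a z).
have coc' : is_cocycle1 c'.
  split=> [b x y|x y]; rewrite /c'.
    rewrite (lin_c b) scalerBr addrACA -opprD scaler_sumr -big_split.
    by congr (_ - _); apply: eq_bigr => a _;
      rewrite (eval_deriv_linear a b) linearP.
  rewrite c_lie !(plinB (act_linearr _)) !(plin_sum (act_linearr _)).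
  have -> : \sum_(a <- s) phi a (eval_deriv a (lie x y)) =
      \sum_(a <- s) act x (phi a (eval_deriv a y)) -
      \sum_(a <- s) act y (phi a (eval_deriv a x)).
    rewrite -sumrB big_seq [RHS]big_seq; apply: eq_bigr => a as_.
    by have [_ ->] := deriv_cocycle (phiP a as_).
  by rewrite !opprB [X in _ + X]addrC addrACA [- _ + _]addrC.
have [|m mP] := whitehead g_simple us suppM coc'.
  move=> x h hs; rewrite /c'.
  under eq_bigr => a _ do rewrite eval_deriv_pure linearZ /= phiE -(plinZ
    lin_c) -(plinZ (lin_r x)).
  rewrite -(plin_sum lin_c) -(plin_sum (lin_r x)).
  (* As h vanishes on [s], it has the same values and derivatives there as the sum of the h'(a)
     f_a. *)
  rewrite (@cocycle_jet_eq c x h (\sum_(a <- s) (h^`()).[a] *: f a)) ?subrr //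
    => b bs.
  rewrite (rootP (allP hs b bs)) horner_sum raddf_sum horner_sum; split.
    by rewrite big1_seq // => a _; rewrite hornerZ (fP b a bs).1 mulr0.
  rewrite (bigD1_seq b) //= big1_seq => [|a /andP[ab _]].
    by rewrite derivZ hornerZ (fP b b bs).2 eqxx mulr1 addr0.
  by rewrite derivZ hornerZ (fP b a bs).2 eq_sym (negPf ab) mulr0.
by exists m => z; rewrite -mP /c' addrC subrK.
Qed.

(** Evaluate at x (x) f_b: it acts by zero on M, and among the derivatives only the one at b
    survives. *)
Lemma cocycle_decomposition_unique (phi : forall a, 'Hom(eval_mod g a, M)) (m :
  M) :
    (forall z, \sum_(a <- s) phi a (eval_deriv a z) = act z m) ->
  forall a, a \in s -> phi a = 0.
Proof.
move=> phi_m b bs; have [f fP] := hermite_polys us.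
apply/lfunP => x; rewrite zero_lfunE.
have <- : act (x *t f b : current g) m = 0.
  by apply: suppM; apply/allP => a as_; rewrite /root (fP a b as_).1.
rewrite -phi_m (bigD1_seq b) //= big1_seq => [|a /andP[ab as_]].
  by rewrite eval_deriv_pure (fP b b bs).2 eqxx scale1r addr0.
by rewrite eval_deriv_pure (fP a b as_).2 (negPf ab) scale0r linear0.
Qed.

(** The product p of the X - b, b in [s], acts by zero on M but through p(a) <> 0 on the source, so
    a morphism kills all brackets. *)
Lemma homs_eval_out a : a \notin s -> homs (eval_mod g a) M = 0%VS.
Proof.
move=> as_; apply/vspaceP=> phi; rewrite memv0.
apply/idP/eqP => [/homsP phiP|->]; last exact: mem0v.
pose p : {poly C} := \prod_(b <- s) ('X - b%:P).
have pa : p.[a] != 0 by rewrite -[_ == 0]/(root p a) root_prod_XsubC.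
apply/lfunP => x; rewrite zero_lfunE.
apply: (@lie_perfect_ind _ _ (fun x : g => phi (x : eval_mod g a) = 0)) =>
  // [|b y z y0 z0|y z].
- exact: linear0.
- by rewrite -[RHS](addr0 0) -{2}z0 -[in RHS](scaler0 _ b) -y0; exact: linearP.
have : phi (act (y *t p : current g) (z : eval_mod g a)) = 0.
  rewrite phiP suppM //; by apply/allP => b bs; rewrite root_prod_XsubC.
rewrite /= /pull_act /= eval_at_pure (plinZ (lie_linearl _)) linearZ /=.
by move/eqP; rewrite scaler_eq0 (negPf pa) => /eqP.
Qed.

End FirstCohomology.

(** * Extensions and cocycles *)

Lemma subrBB (T : zmodType) (a b c d : T) : (a - b) - (c - d) = (a + d) - (b +
  c).
Proof. by rewrite opprB addrACA -opprD. Qed.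

Section TensorHom.
Variables (K : fieldType) (L : lieAlgType K) (V W : lieModule L).
Local Notation M := (tens_mod (dual_mod V) W).

(** The canonical isomorphism from the tensor product with the dual to Hom(V, W), inverse to
    [tens_of_hom]: extensions produce cocycles in Hom(V, W), while the cohomology is computed in the
    tensor module. *)
Definition hom_of_tens (u : M) (v : V) : W :=
  tens_lift (fun (f : dual_mod V) (w : W) => (f v : K) *: w) u.

Lemma hom_of_tens_linearl v : linear (hom_of_tens^~ v).
Proof.
by apply: tens_lift_linear => f a w w'; rewrite scalerDr !scalerA mulrC.
Qed.

Lemma hom_of_tens_pure (f : dual_mod V) (w : W) v :
  hom_of_tens (f *t w) v = (f v : K) *: w.
Proof.
apply: tens_liftE => [w' a f1 f2|f1 a w1 w2].
  by rewrite add_lfunE scale_lfunE scalerDl scalerA.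
by rewrite scalerDr !scalerA mulrC.
Qed.

Lemma hom_of_tens_linearr u : linear (hom_of_tens u).
Proof.
move=> a v v'; pose D z := plinD (hom_of_tens_linearl z).
pose D0 z := plin0 (hom_of_tens_linearl z).
elim/tens_ind: u => [|u u' IHu IHu'|f w]; first by rewrite !D0 scaler0 addr0.
  by rewrite !D IHu IHu' scalerDr addrACA.
by rewrite !hom_of_tens_pure linearP scalerDl scalerA.
Qed.

Lemma hom_of_tens_act x u v :
  hom_of_tens (act x u) v = act x (hom_of_tens u v) - hom_of_tens u (act x v).
Proof.
pose D z := plinD (hom_of_tens_linearl z).
pose D0 z := plin0 (hom_of_tens_linearl z).
elim/tens_ind: u => [|u u' IHu IHu'|f w].
- by rewrite (plin0 (act_linearr x)) !D0 (plin0 (act_linearr x)) subr0.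
- by rewrite (plinD (act_linearr x)) !D IHu IHu' (plinD (act_linearr x)) opprD
    addrACA.
rewrite [act x _]tens_act_pure D !hom_of_tens_pure (plinZ (act_linearr x)).
by rewrite [act x f v]dual_actE scaleNr addrC.
Qed.

Definition tens_of_hom (h : V -> W) : M :=
  \sum_(i < \dim {:V}) (linfun (coord (vbasis {:V}) i : V -> K^o) : dual_mod V)
    *t h (vbasis {:V})`_i.

Lemma coord_linfunE i v : (linfun (coord (vbasis {:V}) i : V -> K^o)) v = coord
  (vbasis {:V}) i v.
Proof. by apply: lfun_linearE => a u w; rewrite linearP. Qed.

Lemma tens_of_homK (h : V -> W) v : linear h -> hom_of_tens (tens_of_hom h) v =
  h v.
Proof.
move=> lin_h; rewrite (plin_sum (hom_of_tens_linearl v)).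
rewrite {2}(coord_vbasis (memvf v)) (plin_sum lin_h); apply: eq_bigr => i _.
by rewrite hom_of_tens_pure coord_linfunE (plinZ lin_h).
Qed.

Lemma hom_of_tensK u : tens_of_hom (hom_of_tens u) = u.
Proof.
elim/tens_ind: u => [|u u' IHu IHu'|f w].
- rewrite /tens_of_hom big1 // => i _; rewrite (plin0 (hom_of_tens_linearl _)).
  exact: (plin0 (@pure_linearr _ _ _ _)).
- rewrite -{2}IHu -{2}IHu' /tens_of_hom -big_split; apply: eq_bigr => i _ /=.
  by rewrite (plinD (hom_of_tens_linearl _)) (plinD (@pure_linearr _ _ _ _)).
rewrite /tens_of_hom.
pose b := vbasis {:V}.
have fE : f = \sum_(i < \dim {:V}) (f b`_i : K) *: (linfun (coord b i : V ->
  K^o) : dual_mod V).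
  apply/lfunP => v; rewrite sum_lfunE {1}(coord_vbasis (memvf v)) linear_sum.
  apply: eq_bigr => i _; rewrite scale_lfunE coord_linfunE linearZ /=.
  exact: mulrC.
rewrite [in RHS]fE (plin_sum (@pure_linearl _ _ _ w)); apply: eq_bigr => i _.
by rewrite hom_of_tens_pure (plinZ (@pure_linearr _ _ _ _)) (plinZ
  (@pure_linearl _ _ _ w)).
Qed.

Lemma hom_of_tens_inj u u' : hom_of_tens u =1 hom_of_tens u' -> u = u'.
Proof.
move=> uu'; rewrite -[u]hom_of_tensK -[u']hom_of_tensK.
by congr tens_of_hom; apply/funext.
Qed.

Section CocycleExtension.
Variable c : L -> M.
Hypothesis coc : is_cocycle1 c.

(** The action on the middle term of the extension built from [c]; the cocycle identity is what
    makes it a Lie action. *)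
Definition twisted_act (x : L) (u : W * V) : W * V :=
  (act x u.1 + hom_of_tens (c x) u.2, act x u.2).

Fact twisted_linearl u : linear (twisted_act^~ u).
Proof.
have [lin_c _] := coc; move=> a x y; rewrite /twisted_act.
rewrite (act_linearl u.1 a) (act_linearl u.2 a) (lin_c a) (hom_of_tens_linearl
  u.2 a).
by congr (_, _); rewrite /= scalerDr addrACA.
Qed.

Fact twisted_linearr x : linear (twisted_act x).
Proof.
move=> a u v; congr (_, _); last exact: act_linearr.
by rewrite /= (act_linearr x a) (hom_of_tens_linearr (c x) a) scalerDr addrACA.
Qed.

Fact twisted_lie x y u :
  twisted_act (lie x y) u =
  twisted_act x (twisted_act y u) - twisted_act y (twisted_act x u).
Proof.
have [_ c_lie] := coc; congr (_, _); rewrite /= ?act_lie // c_lie.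
rewrite (plinB (hom_of_tens_linearl _)) !hom_of_tens_act !(plinD (act_linearr
  _)).
by rewrite subrBB addrACA -opprD -!addrA [hom_of_tens _ _ + act y _]addrC.
Qed.

Definition twisted_mod : lieModule L :=
  LieModule (W * V)%type twisted_act twisted_linearl twisted_linearr
    twisted_lie.

Fact twisted_inj_act x (w : W) :
  ((act x w, 0) : twisted_mod) = act x ((w, 0) : twisted_mod).
Proof.
by congr (_, _); rewrite /= ?(plin0 (act_linearr _)) // (plin0
  (hom_of_tens_linearr _)) addr0.
Qed.

Fact twisted_inj_lin : linear (fun w : W => (w, 0) : twisted_mod).
Proof. by move=> a u v; congr (_, _); rewrite /= scaler0 addr0. Qed.
Fact twisted_proj_lin : linear (fun u : twisted_mod => u.2 : V).
Proof. by []. Qed.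
Fact twisted_proj_act (x : L) (u : twisted_mod) : (act x u).2 = act x u.2 :> V.
Proof. by []. Qed.

Lemma cocycle_extension : exists E : extension V W,
  ext_cocycle E (fun x v => hom_of_tens (c x) v).
Proof.
pose i := mk_hom twisted_inj_lin twisted_inj_act.
pose p := mk_hom twisted_proj_lin twisted_proj_act.
have iE w : i w = (w, 0) := mk_homE _ _ _.
have pE u : p u = u.2 := mk_homE _ _ _.
have i_inj w : i w = 0 -> w = 0 by rewrite iE => -[].
have p_surj v : exists u, p u = v by exists (0, v); rewrite pE.
have pi0 w : p (i w) = 0 by rewrite pE iE.
have ip_ex u : p u = 0 -> exists w, u = i w.
  by case: u => w v; rewrite pE /= => ->; exists w; rewrite iE.
exists (mk_ext i_inj p_surj pi0 ip_ex).
pose s0 (v : V) : twisted_mod := (0, v).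
have s0lin : linear s0 by move=> a u v; congr (_, _); rewrite /= scaler0 addr0.
exists (linfun s0); split=> [v|x v]; rewrite !(lfun_linearE s0lin).
  by rewrite [LHS]pE.
rewrite [ext_inj _ _]iE; congr (_, _).
  by rewrite /= (plin0 (act_linearr _)).
by rewrite /= addr0.
Qed.

End CocycleExtension.

(** A relation rather than a map: the cocycle depends on a section and is determined only up to
    coboundary. *)
Definition represents (t : Ext1 V W) (c : L -> M) : Prop :=
  exists2 E : extension V W, t = ext_class E &
    ext_cocycle E (fun x v => hom_of_tens (c x) v).

Lemma represents_ex c : is_cocycle1 c -> exists t, represents t c.
Proof.
by move=> coc; have [E Ec] := cocycle_extension coc; exists (ext_class E), E.
Qed.

(** [ext_cocycle] imposes neither linearity nor the cocycle identity; both follow from the module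
    structure of the middle term, by injectivity of [ext_inj]. *)
Lemma represents_cocycle t : exists2 c, is_cocycle1 c & represents t c.
Proof.
have [E ->] := ext_classK t; have [gam [sec [secK secE]]] := ext_cocycle_ex E.
have inj := @ext_inj_inj _ _ _ _ E.
have gamE x v : ext_inj E (gam x v) = act x (sec v) - sec (act x v).
  by rewrite secE addrC addKr.
have linr x : linear (gam x).
  move=> a u v; apply: inj; rewrite linearP /= !gamE (act_linearr x a u v).
  rewrite !(linearP sec) (act_linearr x a (sec u)).
  by rewrite scalerBr opprD addrACA.
have linl v : linear (gam^~ v).
  move=> a x y; apply: inj; rewrite linearP /= !gamE.
  rewrite (act_linearl (sec v) a) (act_linearl v a) (linearP sec).
  by rewrite scalerBr opprD addrACA.
have gam_lie x y v : gam (lie x y) v =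
    act x (gam y v) - gam y (act x v) - (act y (gam x v) - gam x (act y v)).
  apply: inj; rewrite !(linearB (ext_inj E)) /= !mod_hom_act !gamE !(plinB
    (act_linearr _)).
  rewrite !act_lie (linearB sec) /= [RHS]subrBB [X in _ = _ - X]addrC !subrKA.
  by rewrite [LHS]subrBB [RHS]subrBB [X in _ - X]addrC.
pose c x := tens_of_hom (gam x).
have cE x v : hom_of_tens (c x) v = gam x v by apply: tens_of_homK.
exists c.
  split=> [a x y|x y]; apply: hom_of_tens_inj => v.
    by rewrite (hom_of_tens_linearl v a) !cE (linl v a).
  by rewrite (plinB (hom_of_tens_linearl _)) !hom_of_tens_act !cE gam_lie.
exists E => //; exists sec; split=> // x v.
by rewrite cE secE.
Qed.

Lemma representsP a t t' c c' : represents t c -> represents t' c' ->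
  represents (a *: t + t') (fun x => a *: c x + c' x).
Proof.
move=> [E -> Ec] [E' -> Ec']; exists (baer_sum (ext_scale a E) E').
  by rewrite ext_classZ ext_classD.
have := baer_cocycle (scale_cocycle a Ec) Ec'.
congr ext_cocycle; apply/funext => x; apply/funext => v.
by rewrite (hom_of_tens_linearl v a).
Qed.

Lemma represents_eq t t' c c' : represents t c -> represents t' c' ->
  t = t' <-> exists m : M, forall x, c' x = c x + act x m.
Proof.
move=> [E -> Ec] [E' -> Ec']; rewrite ext_classP (ext_equivP Ec Ec').
split=> [[h hP]|[m mP]].
  have lin_h : linear h by move=> a u v; rewrite linearP.
  exists (tens_of_hom h) => x; apply: hom_of_tens_inj => v.
  by rewrite (plinD (hom_of_tens_linearl v)) hom_of_tens_act !tens_of_homK //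
    hP addrA.
exists (linfun (hom_of_tens m)) => x v.
rewrite !(lfun_linearE (hom_of_tens_linearr m)) mP.
by rewrite (plinD (hom_of_tens_linearl v)) hom_of_tens_act addrA.
Qed.

End TensorHom.

(** * Dimensions of spaces of morphisms and extensions *)

Section HasDim.
Variable K : fieldType.

(** A linear relation that is bijective between T and the product of the U_i gives T its dimension
    through coordinates in the U_i. It is applied to a class in Ext^1 and its family of
    morphisms. *)
Lemma has_dim_param (T : lmodType K) (E : vectType K) k (U : 'I_k -> {vspace E})
    (Rel : T -> ('I_k -> E) -> Prop) :
    (forall a t t' phi phi', Rel t phi -> Rel t' phi' ->
       Rel (a *: t + t') (fun i => a *: phi i + phi' i)) ->
    (forall t, exists2 phi, forall i, phi i \in U i & Rel t phi) ->
    (forall phi, (forall i, phi i \in U i) -> exists t, Rel t phi) ->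
    (forall t phi phi', (forall i, phi i \in U i) -> (forall i, phi' i \in U i)
      ->
       Rel t phi -> Rel t phi' -> phi =1 phi') ->
    (forall t t' phi, Rel t phi -> Rel t' phi -> t = t') ->
  has_dim T (\sum_(i < k) \dim (U i)).
Proof.
move=> RelP total onto func inj.
pose par t := s2val (cid2 (total t)).
have parU t i : par t i \in U i by exact: (s2valP (cid2 (total t))).
have parR t : Rel t (par t) by exact: (s2valP' (cid2 (total t))).
pose f t : 'rV[K]_(\sum_(i < k) \dim (U i)) :=
  \mxrow_(i < k) (\row_l coord (vbasis (U i)) l (par t i)).
pose vec (r : 'rV[K]_(\sum_(i < k) \dim (U i))) i :=
  \sum_(l < \dim (U i)) (submxrow r i) 0 l *: (vbasis (U i))`_l.
have vecU r i : vec r i \in U i.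
  by apply: memv_suml => l _; rewrite memvZ // vbasis_mem // mem_nth
    ?size_tuple.
pose h r := sval (cid (onto _ (vecU r))).
have hR r : Rel (h r) (vec r) by exact: (svalP (cid (onto _ (vecU r)))).
exists f.
  move=> a t t'.
  (* Both sides are parameters of the same element, so the arbitrary choice [par] is linear. *)
  have parL : par (a *: t + t') =1 (fun i => a *: par t i + par t' i).
    apply: func (parU _) _ (parR _) (RelP _ _ _ _ _ (parR t) (parR t')) => i.
    by rewrite memvD ?memvZ.
  apply/mxrowP => i.
  have -> : submxrow (a *: f t + f t') i = a *: submxrow (f t) i + submxrow (f
    t') i.
    by apply/matrixP => j l; rewrite !mxE.
  rewrite !mxrowK; apply/rowP=> l; rewrite !mxE parL; exact: linearP.
exists h => [t|r].
  apply: (inj _ _ (par t)) (parR t).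
  suff -> : par t = vec (f t) by [].
  apply/funext => i; rewrite /vec mxrowK {1}(coord_vbasis (parU t i)).
  by apply: eq_bigr => l _; rewrite mxE.
apply/mxrowP => i; rewrite mxrowK.
have -> : par (h r) = vec r by apply/funext/(func (h r)).
apply/rowP=> l; rewrite !mxE /vec linear_sum (bigD1 l) //= big1 ?addr0 =>
  [|l' ll'].
  by rewrite linearZ /= coord_free ?(basis_free (vbasisP _)) // eqxx mulr1 mxE.
rewrite linearZ /= coord_free ?(basis_free (vbasisP _)) //.
by rewrite -val_eqE eq_sym in ll' *; rewrite (negPf ll') mulr0.
Qed.

Lemma has_dim_le (T : lmodType K) n m : has_dim T n -> has_dim T m -> (n <=
  m)%N.
Proof.
move=> [f lin_f [f' fK f'K]] [h lin_h [h' hK h'K]].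
have lin_f' : linear f'.
  by move=> a u v; apply: (can_inj fK); rewrite (lin_f a) !f'K.
pose F : 'Hom('rV[K]_n, 'rV[K]_m) := linfun (h \o f').
have FE u : F u = h (f' u).
  by apply: lfun_linearE => a x y /=; rewrite (lin_f' a) (lin_h a).
have F0 : (fullv :&: lker F = 0)%VS.
  apply/vspaceP=> u; rewrite memv_cap memvf memv_ker FE memv0 /=.
  apply/eqP/eqP=> [h0|->]; last by rewrite (plin0 lin_f') (plin0 lin_h).
  by apply: (can_inj f'K); apply: (can_inj hK);
    rewrite h0 (plin0 lin_f') (plin0 lin_h).
have := dimvS (subvf (F @: fullv)%VS); rewrite (limg_dim_eq F0) !dimvf /dim /=.
by rewrite !mul1n.
Qed.

Lemma has_dim_uniq (T : lmodType K) n m : has_dim T n -> has_dim T m -> n = m.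
Proof. by move=> Tn Tm; apply/eqP; rewrite eqn_leq !(has_dim_le Tn Tm,
  has_dim_le Tm Tn). Qed.

Lemma has_dim_nonzero (T : lmodType K) n : has_dim T n -> (0 < n)%N ->
  exists c : T, c != 0.
Proof.
case: n => // n [f lin_f [f' fK f'K]] _; exists (f' (const_mx 1)).
apply/eqP => /(congr1 f); rewrite f'K (plin0 lin_f) => /rowP/(_ ord0).
by rewrite !mxE => /eqP; rewrite oner_eq0.
Qed.

End HasDim.

Section Homs.
Variables (K : fieldType) (L : lieAlgType K).
Implicit Types V W : lieModule L.

Lemma mod_iso_sym V W : mod_iso V W -> mod_iso W V.
Proof.
move=> [f [f' fK f'K]].
have lin_f' : linear f' by move=> a u v; apply: (can_inj fK);
  rewrite linearP /= !f'K.
have act_f' x w : f' (act x w) = act x (f' w).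
  by apply: (can_inj fK); rewrite mod_hom_act !f'K.
exists (mk_hom lin_f' act_f'); exists f => u; rewrite mk_homE;
  [apply: f'K | apply: fK].
Qed.

Lemma mod_iso_homs V W : mod_iso V W ->
  exists2 phi : 'Hom(V, W), phi \in homs V W & bijective phi.
Proof.
by move=> [f bij_f]; exists f => //; apply/homsP; apply: mod_hom_act.
Qed.

Lemma homs_ker V W (phi : 'Hom(V, W)) : irreducible V -> phi \in homs V W ->
  forall v, v != 0 -> phi v = 0 -> phi = 0.
Proof.
move=> [_ Virr] /homsP phiP v v0 phi0.
have [|k0|kf] := Virr (lker phi).
- by move=> x u; rewrite !memv_ker phiP => /eqP ->;
    rewrite (plin0 (act_linearr x)).
- have : v \in lker phi by rewrite memv_ker phi0.
  by rewrite k0 memv0 (negPf v0).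
apply/lfunP => u; rewrite zero_lfunE; apply/eqP.
by rewrite -memv_ker kf memvf.
Qed.

Lemma homs_bij V W (phi : 'Hom(V, W)) : irreducible V -> irreducible W ->
  phi \in homs V W -> phi != 0 -> bijective phi.
Proof.
move=> Virr [_ Wirr] phiV phi0; have phiP := (homsP phi).1 phiV.
have inj : lker phi == 0%VS.
  apply/eqP/vspaceP=> v; rewrite memv_ker memv0; apply/eqP/eqP=> [|->];
    last exact: linear0.
  by move=> pv; apply/eqP; apply: contraNT phi0 => v0;
    apply/eqP/(homs_ker Virr phiV v0 pv).
have [|i0|im] := Wirr (limg phi).
- by move=> x _ /memv_imgP[v _ ->]; rewrite -phiP memv_img ?memvf.
- case/eqP: phi0; apply/lfunP => v; apply/eqP; rewrite zero_lfunE -memv0 -i0.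
  by rewrite memv_img ?memvf.
exists (phi^-1)%VF => w; first exact: lker0_lfunK.
by rewrite limg_lfunVK // im memvf.
Qed.

Lemma homs_iso V W (phi : 'Hom(V, W)) : phi \in homs V W -> bijective phi ->
  mod_iso V W.
Proof. by move/homsP=> phiP bij; exists (ModHom phi phiP). Qed.

Lemma homs_dim_le A V W (f : modHom V W) : injective f ->
  (\dim (homs A V) <= \dim (homs A W))%N.
Proof.
move=> f_inj.
have lin_F : linear (fun phi : 'Hom(A, V) => (f \o phi)%VF).
  move=> a u v; apply/lfunP => x.
  by rewrite !(comp_lfunE, add_lfunE, scale_lfunE) linearP.
pose F : 'Hom('Hom(A, V), 'Hom(A, W)) := linfun (fun phi : 'Hom(A, V) =>
  (f \o phi)%VF).
have FE phi : F phi = (f \o phi)%VF by apply: lfun_linearE.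
have F0 : (homs A V :&: lker F = 0)%VS.
  apply/eqP; rewrite -subv0; apply/subvP => phi;
    rewrite memv_cap memv_ker memv0 FE.
  case/andP=> _ /eqP/lfunP phi0; apply/eqP/lfunP => x; apply: f_inj.
  by have := phi0 x; rewrite comp_lfunE !zero_lfunE linear0.
rewrite -(limg_dim_eq F0) dimvS //; apply/subvP =>
  _ /memv_imgP[phi /homsP phiP ->].
by apply/homsP => x v; rewrite FE !comp_lfunE phiP mod_hom_act.
Qed.

Lemma homs_dim_iso A V W : mod_iso V W -> \dim (homs A V) = \dim (homs A W).
Proof.
move=> VW; apply/eqP; rewrite eqn_leq.
have [f /bij_inj f_inj] := VW; have [h /bij_inj h_inj] := mod_iso_sym VW.
by rewrite (homs_dim_le A f_inj) (homs_dim_le A h_inj).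
Qed.

Lemma triv_dual_tens_iso V : mod_iso (tens_mod (dual_mod (triv_mod L)) V) V.
Proof.
pose f (u : tens_mod (dual_mod (triv_mod L)) V) : V := hom_of_tens u (1 : K^o).
have lin_f : linear f by exact: hom_of_tens_linearl.
have act_f x u : f (act x u) = act x (f u).
  rewrite /f hom_of_tens_act.
  have -> : hom_of_tens u (act x ((1 : K^o) : triv_mod L)) = 0.
    exact: (plin0 (hom_of_tens_linearr u)).
  exact: subr0.
exists (mk_hom lin_f act_f).
have lin_h (v : V) : linear (fun a : K^o => (a : K) *: v).
  by move=> a b c; rewrite scalerDl scalerA.
exists (fun v => tens_of_hom (L := L) (V := triv_mod L) (fun a : K^o =>
  (a : K) *: v)) => [u|v].
  apply: hom_of_tens_inj => a; rewrite tens_of_homK // mk_homE /f.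
  by rewrite -(plinZ (hom_of_tens_linearr u)) [_ *: _]mulr1.
by rewrite mk_homE /f tens_of_homK // scale1r.
Qed.

End Homs.

(** With phi an isomorphism and a an eigenvalue of phi^-1 psi, the morphism psi - a phi kills an
    eigenvector, hence is zero. *)
Lemma schur_homs (C : numClosedFieldType) (L : lieAlgType C) (V W : lieModule
  L) :
  irreducible V -> irreducible W -> (\dim (homs V W) <= 1)%N.
Proof.
move=> Virr Wirr; have [h0|hn0] := eqVneq (homs V W) 0%VS;
  first by rewrite h0 dimv0.
pose phi := vpick (homs V W); have phiV : phi \in homs V W := memv_pick _.
have phi0 : phi != 0 by rewrite vpick0.
have [phi' phiK phi'K] := homs_bij Virr Wirr phiV phi0.
have lin_phi' : linear phi' by move=> a u v; apply: (can_inj phiK);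
  rewrite linearP /= !phi'K.
suff sub : (homs V W <= <[phi]>)%VS by rewrite (leq_trans (dimvS sub)) //
  dim_vline leq_b1.
apply/subvP => psi psiV.
pose h v := phi' (psi v).
have lin_h : linear h by move=> a u v; rewrite /h linearP (lin_phi' a).
have n_gt0 : (0 < \dim {:V})%N by rewrite lt0n dimv_eq0; case: Virr.
(* Transposed because eigenvectors are rows here, while [end_mx] acts on columns. *)
have [a /eigenvalueP[u uH u0]] := eigenvalue_closed (end_mx h)^T n_gt0.
pose b := vbasis {:V}; pose v := \sum_i u 0 i *: b`_i.
have hv : h v = a *: v.
  rewrite (coord_vbasis (memvf (h v))) scaler_sumr; apply: eq_bigr => i _.
  rewrite scalerA; congr (_ *: _); rewrite /v (plin_sum lin_h) linear_sum /=.
  have /rowP/(_ i) := uH; rewrite !mxE => <-; apply: eq_bigr => k _.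
  by rewrite (plinZ lin_h) linearZ /= !mxE.
have v0 : v != 0.
  apply: contra u0 => /eqP v0; apply/eqP/rowP=> i; rewrite mxE.
  have /freeP fb := basis_free (vbasisP {:V}).
  exact: (fb (fun i => u 0 i)).
apply/vlineP; exists a; apply/eqP; rewrite -subr_eq0; apply/eqP.
apply: (homs_ker Virr _ v0).
  by rewrite memvB // memvZ.
rewrite add_lfunE opp_lfunE scale_lfunE -linearZ /= -hv /h phi'K subrr //.
Qed.

(** * The dimension of Ext^1 *)

Section ExtDimension.
Variables (C : numClosedFieldType) (g : finLieAlgType C).
Hypothesis g_simple : simple_lie g.
Implicit Types V W M : lieModule (current g).

Lemma supported_sub (s s' : seq C) M :
  {subset s <= s'} -> supported_on s M -> supported_on s' M.
Proof.
move=> ss' suppM x f /allP fs'; apply: suppM; apply/allP => a as_.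
exact/fs'/ss'.
Qed.

Lemma supported_tens (s : seq C) V W : supported_on s V -> supported_on s W ->
  supported_on s (tens_mod (dual_mod V) W).
Proof.
move=> suppV suppW x f fs u; elim/tens_ind: u => [|u u' IHu IHu'|h w].
- exact: (plin0 (act_linearr _)).
- by rewrite (plinD (act_linearr _)) IHu IHu' addr0.
rewrite [LHS]tens_act_pure suppW // (plin0 (@pure_linearr _ _ _ _)) addr0.
have -> : act (x *t f : current g) h = 0.
  by apply/lfunP => v; rewrite [LHS]dual_actE suppV // linear0 zero_lfunE oppr0.
exact: (plin0 (@pure_linearl _ _ _ w)).
Qed.

(** A class is parametrized by a family of morphisms phi_a, a in [s]: each class has one by
    [cocycle_decomposition], and only one by [cocycle_decomposition_unique]. *)
Lemma Ext1_dim (s : seq C) V W :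
    uniq s -> supported_on s V -> supported_on s W ->
  has_dim (Ext1 V W)
    (\sum_(a <- s) \dim (homs (eval_mod g a) (tens_mod (dual_mod V) W))).
Proof.
move=> us suppV suppW; set M := tens_mod (dual_mod V) W.
have suppM : supported_on s M by exact: supported_tens.
(* All [eval_mod g a] have g as underlying space, so the spaces of morphisms sit in a single [E]. *)
pose E : vectType C := 'Hom(g, M).
pose U (i : 'I_(size s)) : {vspace E} := homs (eval_mod g s`_i) M.
have -> : (\sum_(a <- s) \dim (homs (eval_mod g a) M) = \sum_(i < size s) \dim
  (U i))%N.
  by rewrite (big_nth 0) big_mkord.
pose coc (phi : 'I_(size s) -> E) (z : current g) : M :=
  \sum_i phi i (eval_deriv s`_i z).
(* Reindexes a family from positions in [s] to points; the sum has one term as [s] has no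
   repetition. *)
pose fam (phi : 'I_(size s) -> E) (a : C) : 'Hom(eval_mod g a, M) :=
  \sum_(i < size s | s`_i == a) phi i.
have famE phi (i : 'I_(size s)) : fam phi s`_i = phi i.
  rewrite /fam (eq_bigl (pred1 i)) ?big_pred1_eq // => k.
  by rewrite /= nth_uniq // val_eqE.
have famP phi z : \sum_(a <- s) fam phi a (eval_deriv a z) = coc phi z.
  by rewrite (big_nth 0) big_mkord; apply: eq_bigr => i _; rewrite famE.
have cocP phi : (forall i, phi i \in U i) -> is_cocycle1 (coc phi).
  move=> phiU; split=> [a x y|x y].
    rewrite /coc scaler_sumr -big_split; apply: eq_bigr => i _ /=.
    by rewrite (eval_deriv_linear s`_i a) linearP.
  rewrite /coc !(plin_sum (act_linearr _)) -sumrB; apply: eq_bigr => i _.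
  by have [_ ->] := deriv_cocycle (phiU i).
apply: (@has_dim_param _ _ E _ U (fun t phi => represents t (coc phi))).
- move=> a t t' phi phi' tR t'R; have := representsP a tR t'R.
  congr represents; apply/funext => z.
  rewrite /coc scaler_sumr -big_split; apply: eq_bigr => i _ /=.
  by rewrite add_lfunE scale_lfunE.
- move=> t; have [c cc tc] := represents_cocycle t.
  have [phi phiP [m cE]] := cocycle_decomposition g_simple us suppM cc.
  pose psi (i : 'I_(size s)) : E := phi s`_i.
  have psiU i : psi i \in U i by apply: phiP; rewrite mem_nth.
  exists psi => //; have [t' t'R] := represents_ex (cocP psi psiU).
  suff <- : t' = t by [].
  apply/(represents_eq t'R tc); exists m => z; rewrite cE; congr (_ + _).
  by rewrite (big_nth 0) big_mkord.
- by move=> phi phiU; apply: represents_ex; apply: cocP.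
- move=> t phi phi' phiU phi'U tR t'R i.
  have [m mE] := (represents_eq t'R tR).1 erefl.
  apply/eqP; rewrite -subr_eq0 -[phi i]famE -[phi' i]famE; apply/eqP.
  have := @cocycle_decomposition_unique _ g s M us suppM (fun a =>
    fam phi a - fam phi' a) m.
  apply; last by rewrite mem_nth.
  move=> z; rewrite -[RHS](addKr (coc phi' z)) -mE addrC -!famP -sumrB.
  by apply: eq_bigr => a _; rewrite add_lfunE opp_lfunE.
move=> t t' phi tR t'R; apply/(represents_eq tR t'R); exists 0 => z.
by rewrite (plin0 (act_linearr z)) addr0.
Qed.

Lemma eval_mod_irreducible (a : C) : irreducible (eval_mod g a).
Proof.
have [[x [y xy0]] simp] := g_simple; split=> [|U subU].
  by apply: contra xy0 => /eqP g0; rewrite -memv0 -g0 memvf.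
apply: simp => z w wU; have := subU (z *t 1 : current g) w wU.
by rewrite /= /pull_act /= eval_at_pure hornerC scale1r.
Qed.

Lemma supported_eval_hom (a : C) M (phi : 'Hom(eval_mod g a, M)) :
  phi \in homs (eval_mod g a) M -> bijective phi -> supported_on [:: a] M.
Proof.
move=> /homsP phiP [phi' _ phi'K] x f; rewrite /= andbT => /rootP fa v.
rewrite -[v]phi'K -phiP /= /pull_act /= eval_at_pure fa scale0r.
by rewrite (plin0 (lie_linearl _)) linear0.
Qed.

Lemma triv_supported (s : seq C) : supported_on s (triv_mod (current g)).
Proof. by []. Qed.

Lemma Ext1_triv_dim (s : seq C) V : uniq s -> supported_on s V ->
  has_dim (Ext1 (triv_mod (current g)) V)
    (\sum_(a <- s) \dim (homs (eval_mod g a) V)).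
Proof.
move=> us suppV; have := Ext1_dim us (@triv_supported s) suppV.
by under eq_bigr do rewrite (homs_dim_iso _ (triv_dual_tens_iso V)).
Qed.

(** A nonzero morphism between irreducibles is an isomorphism, so V is supported at a alone; the sum
    has one term, which Schur's lemma makes 1. *)
Lemma Ext1_triv_eval V (a : C) : irreducible V -> homs (eval_mod g a) V != 0%VS
  ->
  has_dim (Ext1 (triv_mod (current g)) V) 1 /\ mod_iso V (eval_mod g a).
Proof.
move=> Virr h0; have Airr := eval_mod_irreducible a.
pose phi := vpick (homs (eval_mod g a) V).
have phiV : phi \in homs (eval_mod g a) V by apply: memv_pick.
have bij : bijective phi by apply: homs_bij; rewrite ?vpick0.
split; last exact/mod_iso_sym/(homs_iso phiV).
have := @Ext1_triv_dim [:: a] V isT (supported_eval_hom phiV bij).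
rewrite big_seq1; suff -> : \dim (homs (eval_mod g a) V) = 1%N by [].
by apply/eqP; rewrite eqn_leq schur_homs // lt0n dimv_eq0.
Qed.

Lemma trivial_action_iso V : irreducible V ->
  (forall z (v : V), act z v = 0) -> mod_iso V (triv_mod (current g)).
Proof.
move=> [V0 Virr] act0; pose v := vpick {:V}; have v0 : v != 0 by rewrite vpick0.
have [|l0|lf] := Virr <[v]>%VS.
- by move=> z w _; rewrite act0 mem0v.
- have : v \in <[v]>%VS by exact: memv_line.
  by rewrite l0 memv0 (negPf v0).
apply: mod_iso_sym.
have lin_f : linear (fun c : triv_mod (current g) => (c : C) *: v).
  by move=> a b c; rewrite scalerDl scalerA.
have act_f z (c : triv_mod (current g)) : (act z c : C) *: v = act z ((c : C)
  *: v).
  by rewrite act0 scale0r.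
exists (mk_hom lin_f act_f).
have ex w : exists c, w = c *: v by apply/vlineP; rewrite lf memvf.
exists (fun w => sval (cid (ex w))) => [c|w].
  case: cid => c'; rewrite mk_homE => /= /eqP; rewrite -subr_eq0 -scalerBl.
  by rewrite scaler_eq0 (negPf v0) orbF subr_eq0 => /eqP.
by rewrite mk_homE; case: cid.
Qed.

(** The map sending x to the action of x (x) e_a on V is a morphism from [eval_mod g a] to the
    tensor module; if all these vanish, g[t] acts trivially and V is the trivial module. *)
Lemma homs_eval_End (s : seq C) V : uniq s -> supported_on s V -> irreducible V
  ->
    ~ mod_iso V (triv_mod (current g)) ->
  exists2 a, a \in s & homs (eval_mod g a) (tens_mod (dual_mod V) V) != 0%VS.
Proof.
move=> us suppV Virr nontriv; apply: contrapT => noa; apply: nontriv.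
apply: trivial_action_iso => // z v; have [e eP] := delta_polys us.
have act_e a : a \in s -> forall x (w : V), act (x *t e a : current g) w = 0.
  move=> as_; pose h x : tens_mod (dual_mod V) V := tens_of_hom (act (x *t e a
    : current g)).
  have hE x w : hom_of_tens (h x) w = act (x *t e a : current g) w.
    by apply: tens_of_homK; apply: act_linearr.
  have lin_h : linear h.
    move=> b x y; apply: hom_of_tens_inj => w.
    by rewrite (hom_of_tens_linearl w b) !hE (act_pure_linearl _ w b).
  pose phi : 'Hom(eval_mod g a, tens_mod (dual_mod V) V) := linfun (h :
    eval_mod g a -> _).
  have phiE x : phi x = h x by apply: lfun_linearE.
  have phiP : phi \in homs (eval_mod g a) (tens_mod (dual_mod V) V).
    apply/homsP => y x; rewrite !phiE; apply: hom_of_tens_inj => w.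
    rewrite hom_of_tens_act !hE -act_lie /= /pull_act /=.
    apply/esym; apply: (supported_ideal (act_linearl w) (fun x f fs =>
      suppV x f fs w)) => b bs.
    exact: eP.
  have phi0 : phi = 0.
    have [h0|h0] := eqVneq (homs (eval_mod g a) (tens_mod (dual_mod V) V)) 0%VS.
      by apply/eqP; rewrite -memv0 -h0.
    by case: noa; exists a.
  by move=> x w; rewrite -hE -phiE phi0 zero_lfunE (plin0 (hom_of_tens_linearl
    w)).
by apply: (supported_act0 us eP suppV) => a as_ x; apply: act_e.
Qed.

End ExtDimension.

Theorem theorem3p8 (R : realType) (g : finLieAlgType R[i])
    (g_simple : simple_lie g)
    (V : lieModule (current g)) (V_irr : irreducible V) :
  [/\ exists2 n, (n <= 1)%N & has_dim (Ext1 (triv_mod (current g)) V) n,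
      has_dim (Ext1 (triv_mod (current g)) V) 1 <->
        (exists a : R[i], mod_iso V (eval_mod g a)),
      forall V' : lieModule (current g), irreducible V' ->
        let d (a : R[i]) :=
          \dim (homs (eval_mod g a) (tens_mod (dual_mod V) V')) in
        finite_set [set a | d a != 0%N] /\
        has_dim (Ext1 V V') (\big[addn/0%N]_(a \in [set: R[i]]) d a)
    & ~ mod_iso V (triv_mod (current g)) ->
        exists c : Ext1 V V, c != 0].
Proof.
have [s us suppV] := irreducible_supported g_simple V_irr.
split.
(* A nonzero morphism from some [eval_mod g a] to V gives dimension 1; without any, every summand is
   zero. *)
- have [[a h0]|noh] := pselect (exists a, homs (eval_mod g a) V != 0%VS).
    by exists 1%N => //; have [] := Ext1_triv_eval g_simple V_irr h0.
  exists 0%N => //; have := Ext1_triv_dim g_simple us suppV.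
  rewrite big1 // => a _; apply/eqP; rewrite dimv_eq0; apply: contrapT => h0.
  by apply: noh; exists a; apply/negP.
- split=> [dim1|[a /mod_iso_sym/mod_iso_homs[phi phiV bij]]]; last first.
    apply: (Ext1_triv_eval g_simple V_irr (a := a) _).1.
    apply: contraTneq phiV => h0; rewrite h0 memv0.
    have [[x [y xy0]] _] := g_simple.
    apply: contra xy0 => /eqP phi0; apply/eqP/(bij_inj bij).
    by rewrite phi0 !zero_lfunE.
  (* If V is no evaluation module, all summands vanish and the dimension would be both 0 and 1. *)
  apply: contrapT => noa; have := Ext1_triv_dim g_simple us suppV.
  rewrite big1 => [/(has_dim_uniq dim1) // | a _].
  apply/eqP; rewrite dimv_eq0; apply: contrapT => /negP h0; apply: noa.
  by exists a; have [] := Ext1_triv_eval g_simple V_irr h0.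
- move=> W W_irr; have [s' us' suppW] := irreducible_supported g_simple W_irr.
  (* A common support for both modules. *)
  pose t := undup (s ++ s'); have ut : uniq t := undup_uniq _.
  have suppVt : supported_on t V.
    by apply: supported_sub suppV => a; rewrite mem_undup mem_cat => ->.
  have suppWt : supported_on t W.
    by apply: supported_sub suppW => a; rewrite mem_undup mem_cat orbC => ->.
  move=> d; have d0 a : a \notin t -> d a = 0%N.
    by move=> at_; rewrite /d (homs_eval_out g_simple (supported_tens suppVt
      suppWt) at_) dimv0.
  split.
    apply: (sub_finite_set _ (finite_seq t)) => a /=; apply: contraNT => /d0 ->.
    exact: eqxx.
  (* Points outside [t] contribute nothing, so the sum over all of C is the finite sum of
     [Ext1_dim]. *)
  rewrite (fsbigE t) //; last by move=> a _; apply: d0.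
  by under eq_bigl do rewrite in_setT; apply: Ext1_dim.
- move=> nontriv; have [a as_ h0] := homs_eval_End us suppV V_irr nontriv.
  apply: (has_dim_nonzero (Ext1_dim g_simple us suppV suppV)).
  by rewrite (bigD1_seq a) //= ltn_addr // lt0n dimv_eq0.
Qed.
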